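(* Let $X=V(F_1,\ldots,F_m,G)\subseteq\mathbb{A}_\kappa^{\ell_1+\cdots+\ell_m+m+2}$ be the fiber defined in the context, with associated $\lambda_1,\ldots,\lambda_m,\mu\in\kappa^\times$. The singular locus of $X$ is described as follows: (1) If $\ell_\alpha=2k_\alpha$ is even for all $\alpha\in\{1,\ldots,m\}$ and $(-1)^{k_1+\cdots+k_m}+\mu=0$, then $\operatorname{Sing}(X)\cong D$, where $D$ is the origin of $\mathbb{A}_\kappa^{\ell_1+\cdots+\ell_m+m+2}$. (2) If $s\ge1$, where $\{1,\ldots,m\}=I_0\cup I_{\alpha_1}\cup\cdots\cup I_{\alpha_s}$ is the partition defined in the context, then $$\operatorname{Sing}(X)\cong\bigcup_{i=1}^sC_i,\qquad C_i:=C_{\alpha_i}:=\bigcup_{\substack{\alpha,\beta\in I_{\alpha_i}\\ \alpha\ne\beta}}C_{\alpha,\beta},$$ where $$C_{\alpha,\beta}:=V(\mathbf z^{(\alpha)},\mathbf z^{(\beta)},u-\xi_u,w-\xi_w)\cap\bigcap_{\substack{\gamma=1\\ \gamma\ne\alpha,\beta}}^mV\big(P_{\ell_\gamma+1}(z_1^{(\gamma)},\ldots,z_{\ell_\gamma+1}^{(\gamma)})-\xi_\gamma\big),$$ for $\mathbf z^{(\alpha)}:=(z_1^{(\alpha)},\ldots,z_{\ell_\alpha+1}^{(\alpha)})$, $\mathbf z^{(\beta)}:=(z_1^{(\beta)},\ldots,z_{\ell_\beta+1}^{(\beta)})$, $\ell_\alpha=2k_\alpha-1$, $\xi_u:=(-1)^{k_\alpha}\lambda_\alpha^{-1}$,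 $\xi_w:=(-1)^{k_\alpha}\lambda_\alpha\mu$, and $\xi_\gamma:=(-1)^{k_\alpha}\lambda_\gamma\lambda_\alpha^{-1}$. (3) In all other cases, $\operatorname{Sing}(X)=\emptyset$, so $X$ is regular.
   Context: **The star cluster algebra.** Let $K$ be a field of any characteristic, $m\geq 1$, and $\ell_1,\ldots,\ell_m$ positive integers. The star-shaped quiver $\mathcal{Q}_\star$ has vertices $0$ and $i^{(\alpha)}$ ($1\le\alpha\le m$, $1\le i\le \ell_\alpha$), all mutable, and arrows $1^{(\alpha)}\to 0$ and $(i+1)^{(\alpha)}\to i^{(\alpha)}$ for $1\le i<\ell_\alpha$. The quiver $\mathcal{Q}_\star^{\mathrm{prin}}$ is obtained by adding, for each mutable vertex $k$, a frozen vertex $k_c$ and one arrow $k_c\to k$. The cluster algebra with principal coefficients $\mathcal{A}_\star^{\mathrm{prin}} := \mathcal{A}(\mathcal{Q}_\star^{\mathrm{prin}})$ (over $K$, coefficient variables invertible) is, since the quiver is acyclic, $$\mathcal{A}_\star^{\mathrm{prin}} \cong K_{\mathbf c}[\mathbf x,\mathbf y,u,v]/\langle g, f_i^{(\alpha)} \mid 1\le\alpha\le m,\ 1\le i\le\ell_\alpha\rangle,$$ where $\mathbf c=(c_0, c_i^{(\alpha)})$, $\mathbf x=(x_i^{(\alpha)})$, $\mathbf y=(y_i^{(\alpha)})$ ($1\le\alpha\le m$, $1\le i\le \ell_\alpha$), $u$, $v$ are independent variables, $K_{\mathbf c}:=K[\mathbf c^{\pm1}]$, $g = uv-c_0\prod_{\alpha=1}^m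 x_1^{(\alpha)}-1$, $f_i^{(\alpha)}=x_i^{(\alpha)}y_i^{(\alpha)}-x_{i-1}^{(\alpha)}-c_i^{(\alpha)}x_{i+1}^{(\alpha)}$ for $i<\ell_\alpha$, $f_{\ell_\alpha}^{(\alpha)}=x_{\ell_\alpha}^{(\alpha)}y_{\ell_\alpha}^{(\alpha)}-x_{\ell_\alpha-1}^{(\alpha)}-c_{\ell_\alpha}^{(\alpha)}$, with the convention $x_0^{(\alpha)}:=u$. **The fiber $X$.** Let $\phi\colon\operatorname{Spec}(\mathcal{A}_\star^{\mathrm{prin}})\to S:=\operatorname{Spec}(K_{\mathbf c})$ be the structure morphism, $\eta\in S$ a closed point, $\kappa=\kappa(\eta)$ the residue field of $\mathcal{O}_{S,\eta}$, and $X:=\phi^{-1}(\eta)$. It is embedded as $$X=V(F_1,\ldots,F_m,G)\subseteq \mathbb{A}_\kappa^{\ell_1+\cdots+\ell_m+m+2}$$ with coordinates $z_1^{(\alpha)},\ldots,z_{\ell_\alpha+1}^{(\alpha)}$ ($1\le \alpha\le m$), $u$, $w$, where $$F_\alpha = P_{\ell_\alpha+1}(z_1^{(\alpha)},\ldots,z_{\ell_\alpha+1}^{(\alpha)})-\lambda_\alpha u,\qquad G = uw-\prod_{\alpha=1}^m P_{\ell_\alpha}(z_1^{(\alpha)},\ldots,z_{\ell_\alpha}^{(\alpha)})-\mu.$$ Here $P_n$ are the continuant polynomials: $P_0=1$, $P_1(z_1)=z_1$, $P_n(z_1,\ldots,z_n)=z_nP_{n-1}(z_1,\ldots,z_{n-1})-P_{n-2}(z_1,\ldots,z_{n-2})$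 for $n\ge2$; and $\lambda_\alpha,\mu\in\kappa^\times$ are the images in $\kappa$ of $(\rho_1^{(\alpha)})^{-1}$ and $c_0^{-1}\big(\prod_{\alpha=1}^m\rho_2^{(\alpha)}\big)^{-1}$, where $\rho_{\ell_\alpha+1}^{(\alpha)}:=1$, $\rho_{\ell_\alpha}^{(\alpha)}:=c_{\ell_\alpha}^{(\alpha)}$, $\rho_i^{(\alpha)}:=c_i^{(\alpha)}\rho_{i+2}^{(\alpha)}$ for $i<\ell_\alpha$. $\operatorname{Sing}(X)$ is the locus of points at which $X$ is not regular. **Compatibility and the partition.** For $\alpha,\beta\in\{1,\ldots,m\}$, $(\ell_\alpha,\lambda_\alpha)$ and $(\ell_\beta,\lambda_\beta)$ are *compatible* if $\alpha=\beta$, or if both $\ell_\alpha=2k_\alpha-1$ and $\ell_\beta=2k_\beta-1$ are odd ($k_\alpha,k_\beta\in\mathbb{Z}_+$) and $\lambda_\alpha(-1)^{k_\alpha}=\lambda_\beta(-1)^{k_\beta}$. Let $I_\alpha:=\{\beta\in\{1,\ldots,m\}\mid(\ell_\alpha,\lambda_\alpha)\text{ and }(\ell_\beta,\lambda_\beta)\text{ are compatible}\}$ and $\sigma(I_\alpha):=\min I_\alpha$. Let $\alpha_1,\ldots,\alpha_s$ be the distinct values $\sigma(I_\alpha)$ over all $\alpha$ with $|I_\alpha|\ge2$ (so for each such $\alpha$ there is a unique $\alpha_i$ with $\alpha_i=\sigma(I_\alpha)$), and $I_0:=\{1,\ldots,m\}\setminus\bigcup_{i=1}^sI_{\alpha_i}$.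 This gives a partition $\{1,\ldots,m\}=I_0\cup I_{\alpha_1}\cup\cdots\cup I_{\alpha_s}$ into disjoint subsets. *)

(* Defs.v *)
From HB Require Import structures.
From mathcomp Require Import all_boot all_order all_algebra.
From mathcomp Require Import generic_quotient.
From mathcomp Require Import boolp classical_sets.
From mathcomp Require Import mpoly.
From mathcomp Require Import ring.

Set Implicit Arguments.
Unset Strict Implicit.
Unset Printing Implicit Defensive.

Import GRing.Theory.
Local Open Scope quotient_scope.
Local Open Scope classical_set_scope.
Local Open Scope ring_scope.

Section Ideals.
Variable R : comNzRingType.

(* Unlike the boolean predicates [idealr] and [prime_idealr] of ring_quotient,
   these are Prop-valued, and an ideal may be the unit ideal. *)
Definition is_ideal (J : set R) : Prop :=
  [/\ J 0, forall a b, J a -> J b -> J (a + b) & forall r a, J a -> J (r * a)].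

Definition is_prime (J : set R) : Prop :=
  [/\ is_ideal J, ~ J 1 & forall a b, J (a * b) -> J a \/ J b].

Definition ideal_gen (G : set R) : set R := smallest is_ideal G.

Lemma ideal_gen_ideal G : is_ideal (ideal_gen G).
Proof.
split=> [J [[]] // |a b Ia Ib J JG|r a Ia J JG].
  by case: (JG) => -[_ HD _] _; apply: HD; [apply: Ia | apply: Ib].
by case: (JG) => -[_ _ HM] _; apply: HM; apply: Ia.
Qed.

Lemma ideal_gen0 a : ideal_gen set0 a -> a = 0.
Proof.
move=> /(_ [set 0]); apply; split=> //; split=> //= [b c -> ->|r b ->].
  by rewrite addr0.
by rewrite mulr0.
Qed.

End Ideals.

Record spec (R : comNzRingType) := Spec {
  ideal_of :> set R;
  ideal_ofP : is_prime ideal_of }.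

(* [ring_of_fractions D] is the ring M^-1 (R / <G>), for a multiplicative set M
   of R that does not meet the ideal <G>.  It is built in one step as the set of
   fractions r / s with s in M, where r / s = r' / s' when t (r s' - r' s) is in
   <G> for some t in M. *)
Record mult_set (R : comNzRingType) (G : set R) := MultSet {
  dens : set R;
  dens1 : dens 1;
  densM : forall s t, dens s -> dens t -> dens (s * t);
  dens_disj : forall s, dens s -> ~ ideal_gen G s }.

Module Fractions.
Section Fractions.
Variables (R : comNzRingType) (G : set R) (M : mult_set G).

Let I0 : ideal_gen G 0. Proof. by case: (ideal_gen_ideal G). Qed.
Let ID a b : ideal_gen G a -> ideal_gen G b -> ideal_gen G (a + b).
Proof. by case: (ideal_gen_ideal G) => _ + _; apply. Qed.
Let IM r a : ideal_gen G a -> ideal_gen G (r * a).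
Proof. by case: (ideal_gen_ideal G) => _ _; apply. Qed.

Record prefrac := Prefrac { frac_pair :> R * R; _ : `[< dens M frac_pair.2 >] }.

HB.instance Definition _ := [isSub for frac_pair].
HB.instance Definition _ := [Choice of prefrac by <:].

Lemma prefracP (x : prefrac) : dens M x.2.
Proof. by case: x => x /= /asboolP. Qed.

Definition mkfrac (r s : R) (Ms : dens M s) : prefrac :=
  @Prefrac (r, s) (asboolT Ms).

Definition eqfrac (x y : prefrac) : bool :=
  `[< exists2 t, dens M t & ideal_gen G (t * (x.1 * y.2 - y.1 * x.2)) >].

Lemma eqfrac_eq (x y : prefrac) : x.1 * y.2 = y.1 * x.2 -> eqfrac x y.
Proof.
by move=> e; apply/asboolP; exists 1; [exact: dens1|rewrite e subrr mulr0].
Qed.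

Lemma eqfrac_equiv : equiv_class_of eqfrac.
Proof.
have sym x y : eqfrac x y -> eqfrac y x.
  move=> /asboolP[t Mt It]; apply/asboolP; exists t => //.
  by rewrite -opprB mulrN -mulN1r; apply: IM.
split=> [x|x y|y x z]; first exact: eqfrac_eq.
  by apply/idP/idP; apply: sym.
move=> /asboolP[t Mt It] /asboolP[t' Mt' It']; apply/asboolP.
exists (t * t' * y.2); first by do 2?apply: densM => //; apply: prefracP.
have -> : t * t' * y.2 * (x.1 * z.2 - z.1 * x.2) =
  (t' * z.2) * (t * (x.1 * y.2 - y.1 * x.2)) +
  (t * x.2) * (t' * (y.1 * z.2 - z.1 * y.2)) by ring.
by apply: ID; apply: IM.
Qed.

Canonical eqfrac_rel := EquivRelPack eqfrac_equiv.

Definition type := {eq_quot eqfrac}.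

HB.instance Definition _ : EqQuotient _ eqfrac type := EqQuotient.on type.
HB.instance Definition _ := Choice.on type.

Lemma eqfrac_repr (x : prefrac) : eqfrac (repr (\pi_type x)) x.
Proof. by apply/eqmodP; rewrite reprK. Qed.

Definition addf (x y : prefrac) : prefrac :=
  mkfrac (x.1 * y.2 + y.1 * x.2) (densM (prefracP x) (prefracP y)).
Definition oppf (x : prefrac) : prefrac := mkfrac (- x.1) (prefracP x).
Definition mulf (x y : prefrac) : prefrac :=
  mkfrac (x.1 * y.1) (densM (prefracP x) (prefracP y)).

Definition zero : type := \pi_type (mkfrac 0 (dens1 M)).
Definition one : type := \pi_type (mkfrac 1 (dens1 M)).
Definition add := lift_op2 type addf.
Definition opp := lift_op1 type oppf.
Definition mul := lift_op2 type mulf.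

Lemma pi_add : {morph \pi : x y / addf x y >-> add x y}.
Proof.
move=> x y; unlock add; apply/eqmodP => /=.
have /asboolP[t Mt It] := eqfrac_repr x; have /asboolP[t' Mt' It'] := eqfrac_repr y.
move: It It'; set x' := repr _; set y' := repr _ => It It'.
apply/asboolP; exists (t * t'); first exact: densM.
set d := (X in ideal_gen G X).
have -> : d = (- (t' * y.2 * y'.2)) * (t * (x'.1 * x.2 - x.1 * x'.2)) +
  (- (t * x.2 * x'.2)) * (t' * (y'.1 * y.2 - y.1 * y'.2)) by rewrite /d /=; ring.
by apply: ID; apply: IM.
Qed.
Canonical pi_add_morph := PiMorph2 pi_add.

Lemma pi_opp : {morph \pi : x / oppf x >-> opp x}.
Proof.
move=> x; unlock opp; apply/eqmodP => /=.
have /asboolP[t Mt] := eqfrac_repr x; set x' := repr _ => It.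
apply/asboolP; exists t => //; set d := (X in ideal_gen G X).
have -> : d = t * (x'.1 * x.2 - x.1 * x'.2) by rewrite /d /=; ring.
exact: It.
Qed.
Canonical pi_opp_morph := PiMorph1 pi_opp.

Lemma pi_mul : {morph \pi : x y / mulf x y >-> mul x y}.
Proof.
move=> x y; unlock mul; apply/eqmodP => /=.
have /asboolP[t Mt It] := eqfrac_repr x; have /asboolP[t' Mt' It'] := eqfrac_repr y.
move: It It'; set x' := repr _; set y' := repr _ => It It'.
apply/asboolP; exists (t * t'); first exact: densM.
set d := (X in ideal_gen G X).
have -> : d = (- (t' * y.1 * y'.2)) * (t * (x'.1 * x.2 - x.1 * x'.2)) +
  (- (t * x.2 * x'.1)) * (t' * (y'.1 * y.2 - y.1 * y'.2)) by rewrite /d /=; ring.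
by apply: ID; apply: IM.
Qed.
Canonical pi_mul_morph := PiMorph2 pi_mul.

Let pi_eq (x y : prefrac) : x.1 * y.2 = y.1 * x.2 -> \pi_type x = \pi_type y.
Proof. by move=> e; apply/eqmodP; apply: eqfrac_eq. Qed.

Lemma addA : associative add.
Proof.
elim/quotW=> x; elim/quotW=> y; elim/quotW=> z.
by rewrite -!pi_add; apply: pi_eq => /=; ring.
Qed.

Lemma addC : commutative add.
Proof.
by elim/quotW=> x; elim/quotW=> y; rewrite -!pi_add; apply: pi_eq => /=; ring.
Qed.

Lemma add0 : left_id zero add.
Proof. by elim/quotW=> x; rewrite -pi_add; apply: pi_eq => /=; ring. Qed.

Lemma addN : left_inverse zero opp add.
Proof. by elim/quotW=> x; rewrite -pi_opp -pi_add; apply: pi_eq => /=; ring. Qed.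

HB.instance Definition _ := GRing.isZmodule.Build type addA addC add0 addN.

Lemma mulA : associative mul.
Proof.
elim/quotW=> x; elim/quotW=> y; elim/quotW=> z.
by rewrite -!pi_mul; apply: pi_eq => /=; ring.
Qed.

Lemma mulC : commutative mul.
Proof.
by elim/quotW=> x; elim/quotW=> y; rewrite -!pi_mul; apply: pi_eq => /=; ring.
Qed.

Lemma mul1 : left_id one mul.
Proof. by elim/quotW=> x; rewrite -pi_mul; apply: pi_eq => /=; ring. Qed.

Lemma mulDf : left_distributive mul add.
Proof.
elim/quotW=> x; elim/quotW=> y; elim/quotW=> z.
by rewrite -pi_add -!pi_mul -pi_add; apply: pi_eq => /=; ring.
Qed.

Lemma one_neq0 : one != zero.
Proof.
apply/negP => /eqP /eqmodP /asboolP[t Mt] /=.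
by rewrite !mulr1 subr0 mulr1; apply: dens_disj Mt.
Qed.

HB.instance Definition _ :=
  GRing.Zmodule_isComNzRing.Build type mulA mulC mul1 mulDf one_neq0.

Definition of_num (r : R) : type := \pi_type (mkfrac r (dens1 M)).

End Fractions.
End Fractions.
HB.export Fractions.

Notation ring_of_fractions := Fractions.type.
Notation of_num := Fractions.of_num.

Section Regularity.
Variable A : comNzRingType.

Definition noetherian : Prop :=
  forall J : set A, is_ideal J -> exists g : seq A, J = ideal_gen [set` g].

Definition prime_chain (d : nat) : Prop :=
  exists Q : 'I_d.+1 -> spec A,
    forall i j : 'I_d.+1, (i < j)%N -> (Q i : set A) `<` Q j.

Definition krull_dim (d : nat) : Prop :=
  prime_chain d /\ forall e, prime_chain e -> (e <= d)%N.

Definition nonunits : set A := [set a | ~ exists b, a * b = 1].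

(* A is local when its nonunits form an ideal, which is then the maximal one. *)
Definition regular_local_ring : Prop :=
  [/\ noetherian, is_ideal nonunits &
      exists2 d, krull_dim d &
        exists2 g : seq A, size g = d & nonunits = ideal_gen [set` g]].

End Regularity.

(* V(G) is also viewed as the closed subscheme Spec (R / <G>), and [local_ring]
   is its local ring at P, namely R_P / <G> R_P. *)
Section Spec.
Variable R : comNzRingType.

Definition zeros (G : set R) : set (spec R) :=
  [set P : spec R | G `<=` P].

Lemma zeros0 (P : spec R) : zeros set0 P.
Proof. by []. Qed.

Definition closed_point (P : spec R) : Prop :=
  forall Q : spec R, zeros P Q -> Q = P.

Section LocalRing.
Variables (G : set R) (P : spec R) (GP : zeros G P).

Fact compl1 : (~` P) 1.
Proof. by case: (ideal_ofP P). Qed.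
Fact complM s t : (~` P) s -> (~` P) t -> (~` P) (s * t).
Proof. by case: (ideal_ofP P) => _ _ PM Ps Pt /PM[]. Qed.
Fact compl_disj s : (~` P) s -> ~ ideal_gen G s.
Proof. by case: (ideal_ofP P) => Pi _ _ Ps /(_ P) Gs; apply/Ps/Gs. Qed.

Definition local_ring : comNzRingType :=
  ring_of_fractions (MultSet compl1 complM compl_disj).

Definition to_local_ring (r : R) : local_ring := of_num _ r.

End LocalRing.

Definition regular_at (G : set R) (P : spec R) (GP : zeros G P) : Prop :=
  regular_local_ring (local_ring GP).

Definition Sing (G : set R) : set (spec R) :=
  [set P | exists GP : zeros G P, ~ regular_at GP].

Definition regular_scheme (G : set R) : Prop :=
  forall (P : spec R) (GP : zeros G P), regular_at GP.

End Spec.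

(* The continuant P_n (z 1, ..., z n); the value z 0 is not used. *)
Fixpoint continuant (R : pzRingType) (z : nat -> R) (n : nat) : R :=
  match n with
  | 0 => 1
  | n1.+1 => match n1 with
             | 0 => z 1%N
             | n2.+1 => z n * continuant z n1 - continuant z n2
             end
  end.

(* For s = [:: c_i; ...; c_l] this is rho_i, given by rho_i = c_i rho_(i+2),
   with the conventions rho_(l+1) = rho_(l+2) = 1. *)
Fixpoint rho (R : pzRingType) (s : seq R) : R :=
  match s with
  | a :: _ :: s' => a * rho s'
  | [:: a] => a
  | [::] => 1
  end.

Section Base.
Variables (K : fieldType) (m : nat) (l : 'I_m -> nat).

(* [None] indexes c_0 and [Some (Tagged _ i)] indexes c_(i+1)^(alpha), where
   alpha is the tag. *)
Definition cindex := option {a : 'I_m & 'I_(l a)}.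

Definition cpoly := {mpoly K[#|{: cindex}|]}.

Fact monomials1 : [set p : cpoly | exists e, p = 'X_[e]] 1.
Proof. by exists 0%MM; rewrite mpolyX0. Qed.
Fact monomialsM (p q : cpoly) :
  [set p : cpoly | exists e, p = 'X_[e]] p ->
  [set p : cpoly | exists e, p = 'X_[e]] q ->
  [set p : cpoly | exists e, p = 'X_[e]] (p * q).
Proof. by move=> [e ->] [e' ->]; exists (e + e')%MM; rewrite mpolyXD. Qed.
Fact monomials_disj (p : cpoly) :
  [set p : cpoly | exists e, p = 'X_[e]] p -> ~ ideal_gen set0 p.
Proof. by move=> [e ->] /ideal_gen0/(congr1 (mcoeff e))/eqP; rewrite mcoeffX mcoeff0 eqxx oner_eq0. Qed.

Definition laurent_ring : comNzRingType :=
  ring_of_fractions (MultSet monomials1 monomialsM monomials_disj).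

Definition cvar (j : cindex) : laurent_ring := of_num _ 'X_(enum_rank j).

Section Images.
Variables (eta : spec laurent_ring) (kappa : fieldType).
Variable res : {rmorphism local_ring (zeros0 eta) -> kappa}.

Definition c_image (j : cindex) : kappa := res (to_local_ring _ (cvar j)).

Definition c_seq (a : 'I_m) : seq kappa :=
  [seq c_image (Some (Tagged (fun a => 'I_(l a)) i)) | i <- enum 'I_(l a)].

Definition lambda (a : 'I_m) : kappa := (rho (c_seq a))^-1.

Definition mu : kappa :=
  (c_image None)^-1 * (\prod_(a < m) rho (behead (c_seq a)))^-1.

End Images.
End Base.

Section Fiber.
Variables (kappa : fieldType) (m : nat) (l : 'I_m -> nat).
Variables (lambda : 'I_m -> kappa) (mu : kappa).

(* The coordinates of the affine space: [inl (Tagged _ i)] is z_(i+1)^(alpha),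
   where alpha is the tag, [inr false] is u and [inr true] is w. *)
Definition coord := ({a : 'I_m & 'I_(l a).+1} + bool)%type.

Definition coord_ring := {mpoly kappa[#|{: coord}|]}.

Lemma card_coord : #|{: coord}| = (\sum_(a < m) l a + m + 2)%N.
Proof.
rewrite card_sum card_bool card_tagged; congr (_ + _)%N.
rewrite sumnE big_map big_enum /=.
under eq_bigr do rewrite card_ord -addn1.
by rewrite big_split /= sum_nat_const card_ord muln1.
Qed.

Definition var (t : coord) : coord_ring := 'X_(enum_rank t).
Definition zvar (a : 'I_m) (i : 'I_(l a).+1) : coord_ring :=
  var (inl (Tagged (fun a => 'I_(l a).+1) i)).
Definition uvar : coord_ring := var (inr false).
Definition wvar : coord_ring := var (inr true).

(* z_1, ..., z_(l+1), numbered from 1 as in [continuant]. *)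
Definition zseq (a : 'I_m) (i : nat) : coord_ring := zvar (inord i.-1 : 'I_(l a).+1).

Definition F (a : 'I_m) : coord_ring :=
  continuant (zseq a) (l a).+1 - (lambda a)%:MP * uvar.

Definition G : coord_ring :=
  uvar * wvar - \prod_(a < m) continuant (zseq a) (l a) - mu%:MP.

Definition X : set coord_ring := range F `|` [set G].

Definition origin : set (spec coord_ring) := zeros (range var).

(* k with n = 2 k - 1, for n odd. *)
Definition odd_half (n : nat) : nat := n.+1./2.

Definition sgn_lambda (a : 'I_m) : kappa := lambda a * (-1) ^+ odd_half (l a).

Definition compatible : rel 'I_m := fun a b =>
  (a == b) || [&& odd (l a), odd (l b) & sgn_lambda a == sgn_lambda b].

Definition compat_class (a : 'I_m) : {set 'I_m} := [set b | compatible a b]%SET.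

Definition sigma (a : 'I_m) : 'I_m := [arg min_(b < a in compat_class a) b].

(* The set {alpha_1, ..., alpha_s}. *)
Definition class_reps : {set 'I_m} :=
  [set sigma a | a : 'I_m & (2 <= #|compat_class a|)%N]%SET.

Definition C_pair (a b : 'I_m) : set (spec coord_ring) :=
  let xi_u : kappa := (-1) ^+ odd_half (l a) * (lambda a)^-1 in
  let xi_w : kappa := (-1) ^+ odd_half (l a) * lambda a * mu in
  let xi (c : 'I_m) : kappa :=
    (-1) ^+ odd_half (l a) * lambda c * (lambda a)^-1 in
  zeros (range (@zvar a) `|` range (@zvar b) `|`
         [set uvar - xi_u%:MP; wvar - xi_w%:MP]) `&`
  \bigcap_(c in [set c | c != a /\ c != b])
    zeros [set continuant (zseq c) (l c).+1 - (xi c)%:MP].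

Definition C_class (r : 'I_m) : set (spec coord_ring) :=
  \bigcup_(p in [set p : 'I_m * 'I_m |
      [/\ p.1 \in compat_class r, p.2 \in compat_class r & p.1 != p.2]])
    C_pair p.1 p.2.

Definition all_even_case : Prop :=
  exists2 k : 'I_m -> nat, (forall a, l a = (2 * k a)%N) &
    (-1) ^+ (\sum_(a < m) k a) + mu = 0.

Definition compatible_case : Prop := (1 <= #|class_reps|)%N.

End Fiber.

(* Main.v *)
(* The fiber X is cut out by m + 1 equations in a polynomial ring over a field, whose local
   rings are regular.  At a prime P of X where the differentials of the equations are
   independent modulo P, the equations are part of a regular system of parameters, and X is
   regular at P.  At a point where one equation lies, modulo P^2, in the ideal of the others,
   the maximal ideal of the local ring needs too many generators, because every prime
   containing X near P has height at least m + 1: each equation forces a variable on which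
   the prime depends.  Both arguments rest on Krull's principal ideal theorem, in the form
   that a chain of n + 1 primes ending at P can be replaced, for f in P, by a chain of n
   primes ending at P that all contain f.

   A relation b dG + sum_a r_a dF_a = 0 modulo P is solved block by block.  If b is in P,
   two blocks a with r_a not in P have all partial derivatives of P_(l_a + 1) in P.
   As consecutive continuants are comaximal, this forces l_a odd and z^(a) in P, where
   P_(l_a + 1) is congruent to a sign modulo P^2; F_a and F_b then both determine u, which
   gives compatibility and C_(a,b).  If b is not in P, then u, w and all z are in P. *)

(* The field kappa may be imperfect and P is an arbitrary prime of the fiber, so independence of
   differentials is used only in the direction that yields regularity: a derivation sends P^2 into
   P. Failure of regularity rests instead on explicit congruences: F_a is a multiple of F_b modulo
   P^2 on C_(a,b), and G lies in P^2 at the origin. The local ring at P is studied inside the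
   polynomial ring. Ideals of R_P become ideals up to multipliers outside P ([saturation]), and
   dimensions become lengths of chains of primes below P ([chain_below]). The dimension of X at P is
   compared with the height of P by prolonging a chain above X downwards by m + 1 steps. Two recipes
   for this prolongation are required. On C_(a,b), u is invertible and is the coefficient of w in G,
   so that w is made free first, and then whole blocks. At the origin u lies in P, but every P_(l_a)
   is invertible and is the coefficient of the last variable of its block in F_a, so that these last
   variables are made free first, and G is treated at the end. *)
Require Import Defs.
From HB Require Import structures.
From mathcomp Require Import all_boot all_order all_algebra.
From mathcomp Require Import generic_quotient.
From mathcomp Require Import boolp classical_sets mpoly.
From mathcomp Require Import ring.

Set Implicit Arguments.
Unset Strict Implicit.
Unset Printing Implicit Defensive.

Import GRing.Theory.
Local Open Scope classical_set_scope.
Local Open Scope ring_scope.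

(** * Ideals and noetherian rings *)

(* Lets a prime, which coerces to a set, be applied to ring elements. *)
Identity Coercion fun_of_set : set >-> Funclass.

Section IdealTheory.
Variable R : comNzRingType.
Implicit Types (I J L : set R) (G H : set R) (P Q : spec R) (a b r s x : R).

Lemma ideal0 I : is_ideal I -> I 0. Proof. by case. Qed.
Lemma idealD I a b : is_ideal I -> I a -> I b -> I (a + b).
Proof. by case=> _ + _; apply. Qed.
Lemma idealMl I r a : is_ideal I -> I a -> I (r * a).
Proof. by case=> _ _; apply. Qed.
Lemma idealMr I r a : is_ideal I -> I a -> I (a * r).
Proof. by rewrite mulrC; exact: idealMl. Qed.
Lemma idealN I a : is_ideal I -> I a -> I (- a).
Proof. by rewrite -mulN1r; exact: idealMl. Qed.
Lemma idealB I a b : is_ideal I -> I a -> I b -> I (a - b).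
Proof. by move=> iI Ia Ib; apply: idealD => //; apply: idealN. Qed.
Lemma idealDl I a b : is_ideal I -> I b -> I (a + b) <-> I a.
Proof.
move=> iI Ib; split=> [Iab|Ia]; last exact: idealD.
by rewrite -(addrK b a); apply: idealB.
Qed.
Lemma ideal_sum I (T : Type) (e : seq T) (p : pred T) (F : T -> R) : is_ideal I ->
  (forall t, p t -> I (F t)) -> I (\sum_(t <- e | p t) F t).
Proof.
move=> iI IF; elim/big_ind: _ => //; [exact: ideal0|by move=> *; apply: idealD].
Qed.

Lemma primeI P : is_ideal P. Proof. by case: (ideal_ofP P). Qed.
Lemma prime1 P : ~ P 1. Proof. by case: (ideal_ofP P). Qed.
Lemma primeM P a b : P (a * b) -> P a \/ P b.
Proof. by case: (ideal_ofP P) => _ _; apply. Qed.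
Lemma primeMn P a b : ~ P a -> ~ P b -> ~ P (a * b).
Proof. by move=> Pa Pb /primeM[]. Qed.
Lemma prime_prod P (T : Type) (e : seq T) (p : pred T) (F : T -> R) :
  (forall t, p t -> ~ P (F t)) -> ~ P (\prod_(t <- e | p t) F t).
Proof.
by move=> PF; elim/big_ind: _ => //; [exact: prime1|move=> *; apply: primeMn].
Qed.
Lemma prime_unit P a b : a * b = 1 -> ~ P a.
Proof. by move=> ab Pa; apply: (@prime1 P); rewrite -ab; apply: idealMr Pa; exact: primeI. Qed.

Lemma spec_inj P Q : (P : set R) = Q -> P = Q.
Proof. by case: P Q => [p pP] [q qP] /= e; subst q; congr Spec; apply: Prop_irrelevance. Qed.

Lemma ideal_gen_sub G : G `<=` ideal_gen G. Proof. by move=> a Ga J [_]; apply. Qed.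
Lemma ideal_gen_min I G : is_ideal I -> G `<=` I -> ideal_gen G `<=` I.
Proof. by move=> iI GI a; apply. Qed.
Lemma ideal_gen_id I : is_ideal I -> ideal_gen I = I.
Proof. by move=> iI; apply/seteqP; split; [exact: ideal_gen_min|exact: ideal_gen_sub]. Qed.
Lemma ideal_genS G H : G `<=` H -> ideal_gen G `<=` ideal_gen H.
Proof.
move=> GH; apply: ideal_gen_min; first exact: ideal_gen_ideal.
by apply: subset_trans GH _; exact: ideal_gen_sub.
Qed.

Lemma ideal_genU1 G x a : ideal_gen (G `|` [set x]) a ->
  exists r, ideal_gen G (a - r * x).
Proof.
have iG := ideal_gen_ideal G.
suff: ideal_gen (G `|` [set x]) `<=` [set a | exists r, ideal_gen G (a - r * x)] by apply.
move=> {a}; apply: ideal_gen_min; first split.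
- by exists 0; rewrite mul0r subr0; exact: ideal0 iG.
- move=> a b [r ar] [s bs]; exists (r + s).
  by rewrite [X in ideal_gen _ X](_ : _ = (a - r * x) + (b - s * x)); [exact: (idealD iG)|ring].
- move=> s a [r ar]; exists (s * r).
  by rewrite [X in ideal_gen _ X](_ : _ = s * (a - r * x)); [exact: (idealMl _ iG)|ring].
- move=> a [Ga|/= ->]; last by exists 1; rewrite mul1r subrr; exact: ideal0 iG.
  by exists 0; rewrite mul0r subr0; apply: ideal_gen_sub.
Qed.

Lemma ideal_gen_principal x a : ideal_gen [set x] a <-> exists r, a = r * x.
Proof.
split=> [|[r ->]]; last by apply: (idealMl _ (ideal_gen_ideal _)); exact: ideal_gen_sub.
rewrite -(set0U [set x]) => /ideal_genU1[r /ideal_gen0/eqP].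
by rewrite subr_eq0 => /eqP ->; exists r.
Qed.

Definition ideal_sumset I J : set R := [set a | exists b c, [/\ I b, J c & a = b + c]].

Lemma ideal_sumset_ideal I J : is_ideal I -> is_ideal J -> is_ideal (ideal_sumset I J).
Proof.
move=> iI iJ; split.
- by exists 0, 0; split; [exact: ideal0|exact: ideal0|rewrite addr0].
- move=> _ _ [b [c [Ib Jc ->]]] [b' [c' [Ib' Jc' ->]]].
  by exists (b + b'), (c + c'); split; [exact: idealD|exact: idealD|rewrite addrACA].
- move=> r _ [b [c [Ib Jc ->]]].
  by exists (r * b), (r * c); split; [exact: idealMl|exact: idealMl|rewrite mulrDr].
Qed.

Lemma ideal_genU G H : ideal_gen (G `|` H) = ideal_sumset (ideal_gen G) (ideal_gen H).
Proof.
have [iG iH] := (ideal_gen_ideal G, ideal_gen_ideal H).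
have iGH := ideal_gen_ideal (G `|` H).
apply/seteqP; split=> [|_ [b [c [Gb Hc ->]]]].
  apply: ideal_gen_min; first exact: ideal_sumset_ideal.
  move=> a [Ga|Ha]; [exists a, 0|exists 0, a]; split; rewrite ?addr0 ?add0r //;
    (try by apply: ideal0); exact: ideal_gen_sub.
by apply: (idealD iGH); [move: b Gb|move: c Hc]; apply: ideal_genS => a; [left|right].
Qed.

Lemma set_cons x (g : seq R) : [set` x :: g] = [set` g] `|` [set x].
Proof.
apply/seteqP; split=> a /=; rewrite inE.
  by case/orP => [/eqP ->|]; [right|left].
by case=> [->|->]; rewrite ?eqxx ?orbT.
Qed.

Lemma set_cat (g h : seq R) : [set` g ++ h] = [set` g] `|` [set` h].
Proof.
by apply/seteqP; split=> a /=; rewrite mem_cat => /orP.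
Qed.

Lemma set_nil : [set` [::] : seq R] = set0. Proof. by apply/seteqP; split. Qed.

(** Without a maximal member, choice yields a strictly increasing sequence in [F]. Its union is an
    ideal, and finitely many generators of it already lie in one term. *)
Lemma noetherian_max (F : set (set R)) I : noetherian R ->
  (forall J, F J -> is_ideal J) -> F I ->
  exists J, [/\ F J, I `<=` J & forall L, F L -> J `<=` L -> L `<=` J].
Proof.
move=> noeth Fi FI; apply: contrapT => nmax.
pose T := {J | F J /\ I `<=` J}.
have /choice[f fP] : forall t : T, exists t' : T,
    sval t `<=` sval t' /\ ~ sval t' `<=` sval t.
  move=> [J [FJ IJ]]; apply: contrapT => nJ; apply: nmax; exists J; split=> // L FL JL.
  apply: contrapT => nLJ; apply: nJ.
  by exists (exist _ L (conj FL (subset_trans IJ JL))).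
pose t0 : T := exist _ I (conj FI (@subset_refl _ I)).
pose s n : set R := sval (iter n f t0).
have sS n : s n `<=` s n.+1 by case: (fP (iter n f t0)).
have sle n n' : (n <= n')%N -> s n `<=` s n'.
  elim: n' => [|n' IHn]; first by rewrite leqn0 => /eqP ->.
  by rewrite leq_eqVlt => /predU1P[->//|]; rewrite ltnS => /IHn h; apply: subset_trans (sS _).
have si n : is_ideal (s n) by apply: Fi; rewrite /s; case: (iter n f t0) => J [].
have iU : is_ideal (\bigcup_n s n).
  split; first by exists 0%N => //; exact: ideal0.
    move=> a b [n _ sa] [n' _ sb]; exists (maxn n n') => //.
    by apply: idealD => //; [apply: sle sa; exact: leq_maxl|apply: sle sb; exact: leq_maxr].
  by move=> r a [n _ sa]; exists n => //; apply: idealMl.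
have [g gU] := noeth _ iU.
have [N gN] : exists N, [set` g] `<=` s N.
  have: [set` g] `<=` \bigcup_n s n by rewrite gU; exact: ideal_gen_sub.
  elim: {gU}g => [|x g IHg] gs; first by exists 0%N.
  have [|N gN] := IHg; first by move=> a /= ga; apply: gs; rewrite /= inE ga orbT.
  have [n _ sx] : (\bigcup_n s n) x by apply: gs; rewrite /= mem_head.
  exists (maxn n N); rewrite set_cons => a [/gN|/= ->].
    exact: sle (leq_maxr _ _) _.
  exact: sle (leq_maxl _ _) _ sx.
have [_ nsub] := fP (iter N f t0); apply: nsub => a sa.
have : (\bigcup_n s n) a by exists N.+1.
by rewrite gU; apply: ideal_gen_min => //; exact: si.
Qed.

End IdealTheory.
(** * Krull's principal ideal theorem *)

Section LocalDomain.
Variable A : comNzRingType.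
Hypotheses (noeth : noetherian A) (loc : is_ideal (nonunits (A := A))).
Hypothesis dom : forall a b : A, a * b = 0 -> a = 0 \/ b = 0.

Let unitP (a : A) : ~ nonunits a -> exists b, a * b = 1.
Proof. by move=> /contrapT. Qed.

Let unit1B (a : A) : nonunits a -> exists b, (1 - a) * b = 1.
Proof.
move=> na; apply: unitP => n1a; have: nonunits (1 : A).
  by rewrite -(subrK a 1); apply: (idealD loc).
by apply; exists 1; rewrite mulr1.
Qed.

Section Principal.
Variables (x y : A) (Q : spec A).
Hypotheses (nQx : ~ Q x) (Qy : Q y) (y_neq0 : y <> 0).
Hypothesis minx : forall P : spec A, P x -> @nonunits A `<=` P.

(* Over a domain these can stand for the symbolic powers of Q in Krull's proof. *)
Let symb n : set A := [set a | exists2 s, ~ Q s & exists r, s * a = r * y ^+ n].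

Let symb_ideal n : is_ideal (symb n).
Proof.
split.
- by exists 1; [exact: prime1|exists 0; rewrite mulr0 mul0r].
- move=> a b [s Qs [r e]] [s' Qs' [r' e']]; exists (s * s'); first exact: primeMn.
  exists (s' * r + s * r'); rewrite mulrDl -!mulrA -e -e'; ring.
- move=> r a [s Qs [r' e]]; exists s => //; exists (r * r').
  by rewrite mulrCA e mulrA.
Qed.

Let symbS n : symb n.+1 `<=` symb n.
Proof.
by move=> a [s Qs [r e]]; exists s => //; exists (r * y); rewrite e exprS mulrA.
Qed.

(** As [x] lies outside [Q], it can be absorbed into the denominator. *)
Let symbMx n a : symb n (a * x) -> symb n a.
Proof.
move=> [s Qs [r e]]; exists (s * x); first exact: primeMn.
by exists r; rewrite -e; ring.
Qed.

Let stab n : set A := ideal_gen (symb n `|` [set x]).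
Let stab_ideal n : is_ideal (stab n) := ideal_gen_ideal _.
Let stabS n : stab n.+1 `<=` stab n.
Proof. by apply: ideal_genS => a [/symbS|]; [left|right]. Qed.

Let stabilises (L : set A) : Prop :=
  exists n0, forall n, (n0 <= n)%N -> stab n `&` L `<=` stab n.+1.

(* Let L be maximal among the ideals containing x on which the chain stabilises.  If L were
   proper, some L : b with b outside L would be prime; containing x, it would contain all
   nonunits, and the chain would also stabilise on L + (b).  This replaces the artinian
   property of A / (x). *)
Let stabilisesT : stabilises setT.
Proof.
pose F (L : set A) := [/\ is_ideal L, L x & stabilises L].
have [||L [[iL Lx [n0 Ln0]] _ Lmax]] := @noetherian_max _ F (ideal_gen [set x]) noeth.
- by move=> L [].
- split; [exact: ideal_gen_ideal|exact: ideal_gen_sub|exists 0%N => n _ a [_]].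
  by apply: ideal_genS => b; right.
case: (pselect (L 1)) => [L1|nL1].
  exists n0 => n /Ln0 h a [Sa _]; apply: h; split=> //.
  by rewrite -(mulr1 a); apply: idealMl.
pose quot b : set A := [set a | L (a * b)].
have iquot b : is_ideal (quot b).
  split=> [|a c|r a]; rewrite /quot /=; first by rewrite mul0r; exact: ideal0.
    by rewrite mulrDl; exact: idealD.
  by rewrite -mulrA; exact: idealMl.
pose H (J : set A) := exists2 b, ~ L b & J = quot b.
have [||J [[b nLb ->] _ Jmax]] := @noetherian_max _ H (quot 1) noeth.
- by move=> _ [b _ ->].
- by exists 1.
have qp : is_prime (quot b).
  split=> // [|a c]; first by rewrite /quot /= mul1r.
  rewrite /quot /= => Lacb; apply: contrapT => /not_orP[nLa nLc].
  apply: nLa; apply: (Jmax (quot (c * b))); first by exists (c * b).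
    by move=> d; rewrite /quot /= mulrCA; exact: idealMl.
  by rewrite /quot /= mulrA.
have nuq : @nonunits A `<=` quot b by apply: (minx (P := Spec qp)); exact: idealMr.
pose L' := ideal_gen (L `|` [set b]).
have iL' : is_ideal L' by exact: ideal_gen_ideal.
have LL' : L `<=` L' by move=> a La; apply: ideal_gen_sub; left.
suff sL' : stabilises L'.
  case: nLb; apply: (Lmax L') => //; last by apply: ideal_gen_sub; right.
  by split=> //; apply: LL'.
have L'P a : L' a -> exists r, L (a - r * b).
  by move=> /ideal_genU1[r]; rewrite ideal_gen_id //; exists r.
(* Either the chain cut with [L'] eventually falls into [L], where it stabilises, or every
   [stab n.+1] contains some [a] in [L'] outside [L]. In the latter case [a] is [r * b] modulo [L]
   with [r] invertible, so any [c] in [L'] is brought into [L] by subtracting a multiple of [a]. *)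
case: (pselect (exists n1, stab n1 `&` L' `<=` L)) => [[n1 hn1]|nn1].
  exists (maxn n0 n1) => n; rewrite geq_max => /andP[le0 le1] a [Sa L'a].
  apply: (Ln0 n) => //; split=> //; apply: hn1; split=> //.
  elim: n {le0} le1 a Sa {L'a} => [|n IHn]; first by rewrite leqn0 => /eqP ->.
  rewrite leq_eqVlt => /predU1P[->//|]; rewrite ltnS => /IHn h a /stabS; exact: h.
exists n0 => n le0 c [Sc L'c].
have [a [[Sa L'a] nLa]] : exists a, (stab n.+1 `&` L') a /\ ~ L a.
  apply: contrapT => nex; apply: nn1; exists n.+1 => a Ha.
  by apply: contrapT => nLa; apply: nex; exists a.
have [r Lr] := L'P _ L'a; have [r' Lr'] := L'P _ L'c.
have /unitP[r1 rr1] : ~ nonunits r.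
  move=> /nuq Lrb; apply: nLa; rewrite -(subrK (r * b) a).
  exact: idealD.
have Sa' : stab n.+1 (r' * r1 * a) by exact: (idealMl _ (stab_ideal _)).
rewrite -(subrK (r' * r1 * a) c).
apply: (idealD (stab_ideal _)) => //; apply: (Ln0 n le0); split.
  by apply: (idealB (stab_ideal _)) => //; exact: stabS.
rewrite [X in L X](_ : _ = (c - r' * b) - r' * r1 * (a - r * b) + r' * b * (1 - r * r1));
  last by ring.
rewrite rr1 subrr mulr0 addr0.
by apply: idealB => //; exact: idealMl.
Qed.

(** Stabilisation modulo [x] and [symbMx] give [symb n = symb n.+1 + x * symb n] for some [n], and a
    Nakayama argument removes the last term. Then [s * y ^+ n = r * y ^+ n.+1] with [s] outside [Q];
    cancelling [y ^+ n] in the domain puts [s] into [Q]. *)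
Lemma nonminimal_over_principal_aux : nonunits x -> False.
Proof.
move=> nux; have [n /(_ n (leqnn n)) stabn] := stabilisesT.
have dec a : symb n a -> exists2 b, symb n.+1 b & exists2 r, symb n r & a = b + r * x.
  move=> sa; have [|r] := @ideal_genU1 _ (symb n.+1) x a.
    by apply: stabn; split=> //; apply: ideal_gen_sub; left.
  rewrite ideal_gen_id // => sar; exists (a - r * x) => //; exists r; last by rewrite subrK.
  by apply: symbMx; rewrite -(subKr a (r * x)); apply: idealB => //; exact: symbS.
(* Nakayama by maximality: if [L] is maximal in [F] above [symb n.+1] and [b] in [symb n] is outside
   [L], then [symb n] lies in [L + (b)], so [(1 - t * x) * b] is in [L] for some [t], and
   [1 - t * x] is a unit. *)
pose F L := is_ideal L /\ ~ symb n `<=` L.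
have sub : symb n `<=` symb n.+1.
  apply: contrapT => nsub.
  have [||L [[iL nL] SL Lmax]] := @noetherian_max _ F (symb n.+1) noeth; [by move=> L []|by split|].
  apply: nL => b sb; apply: contrapT => nLb.
  have hL : symb n `<=` ideal_gen (L `|` [set b]).
    apply: contrapT => nh; apply: nLb; apply: (Lmax (ideal_gen (L `|` [set b]))).
    - by split=> //; exact: ideal_gen_ideal.
    - by move=> a La; apply: ideal_gen_sub; left.
    - by apply: ideal_gen_sub; right.
  have [c /SL Lc [r /hL/ideal_genU1[t]]] := dec _ sb.
  rewrite ideal_gen_id // => Lrt eb.
  have [u tu] : exists u, (1 - t * x) * u = 1 by apply: unit1B; exact: (idealMl _ loc).
  apply: nLb; rewrite -(mul1r b) -tu mulrAC; apply: idealMr => //.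
  rewrite [X in L X](_ : _ = c + (r - t * b) * x); first by apply: idealD => //; exact: idealMr.
  by rewrite mulrBl mul1r {1}eb; ring.
have [|s Qs [r]] := sub (y ^+ n); first by exists 1; [exact: prime1|exists 1].
rewrite exprS mulrA => /eqP; rewrite -subr_eq0 -mulrBl => /eqP /dom[/eqP|].
  by rewrite subr_eq0 => /eqP es; apply: Qs; rewrite es; apply: idealMl => //; exact: primeI.
elim: n {stabn dec F sub} => [|n IHn]; first by rewrite expr0 => /eqP; rewrite oner_eq0.
by rewrite exprS => /dom[/y_neq0|].
Qed.
End Principal.

Lemma nonminimal_over_principal (x y : A) (Q : spec A) :
  nonunits x -> ~ Q x -> Q y -> y <> 0 ->
  exists P : spec A, P x /\ exists2 b, nonunits b & ~ P b.
Proof.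
move=> nux nQx Qy y0; apply: contrapT => nex.
apply: (nonminimal_over_principal_aux nQx Qy y0 _ nux) => P Px b nb.
by apply: contrapT => nPb; apply: nex; exists P; split=> //; exists b.
Qed.
End LocalDomain.
(** * Localisation *)

Section FractionTheory.
Local Open Scope quotient_scope.
Variables (R : comNzRingType) (G : set R) (M : mult_set G).
Implicit Types (r s : R).

Let pi_eq (x y : Fractions.prefrac M) :
  x.1 * y.2 = y.1 * x.2 -> \pi_(ring_of_fractions M) x = \pi y.
Proof. by move=> e; apply/eqmodP; exact: Fractions.eqfrac_eq. Qed.

Lemma of_numD r s : of_num M (r + s) = of_num M r + of_num M s.
Proof. by apply: (etrans _ (Fractions.pi_add _ _)); apply: pi_eq => /=; ring. Qed.

Lemma of_numM r s : of_num M (r * s) = of_num M r * of_num M s.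
Proof. by apply: (etrans _ (Fractions.pi_mul _ _)); apply: pi_eq => /=; ring. Qed.

Lemma of_num1 : of_num M 1 = 1. Proof. by []. Qed.

Lemma of_num_eq0 r : of_num M r = 0 <-> exists2 t, dens M t & ideal_gen G (t * r).
Proof.
have e t : t * (r * 1 - 0 * 1) = t * r by ring.
split=> [/eqmodP/asboolP[t Mt]|[t Mt It]] /=.
  by rewrite e; exists t.
by apply/eqmodP/asboolP; exists t => //; rewrite e.
Qed.

Lemma of_num_unit s : dens M s -> exists b, of_num M s * b = 1.
Proof.
move=> Ms; exists (\pi_(ring_of_fractions M) (Fractions.mkfrac 1 Ms)).
by apply: (etrans (esym (Fractions.pi_mul _ _))); apply: pi_eq => /=; ring.
Qed.

Lemma of_num_repr (a : ring_of_fractions M) :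
  exists r s, dens M s /\ a * of_num M s = of_num M r.
Proof.
elim/quotW: a => x; exists x.1, x.2; split; first exact: Fractions.prefracP.
by apply: (etrans (esym (Fractions.pi_mul _ _))); apply: pi_eq => /=; ring.
Qed.

End FractionTheory.

Section LocalRingTheory.
Variables (R : comNzRingType) (G : set R) (P : spec R) (GP : zeros G P).
Implicit Types (r s : R) (I J : set R).
Notation A := (local_ring GP).
Notation tau := (to_local_ring GP).
Let M := MultSet (@compl1 R P) (@complM R P) (compl_disj GP).

Lemma to_local_ringD r s : tau (r + s) = tau r + tau s. Proof. exact: of_numD. Qed.
Lemma to_local_ringM r s : tau (r * s) = tau r * tau s. Proof. exact: of_numM. Qed.
Lemma to_local_ring1 : tau 1 = 1. Proof. exact: of_num1. Qed.
Lemma to_local_ring_eq0 r : tau r = 0 <-> exists2 t, ~ P t & ideal_gen G (t * r).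
Proof. exact: (@of_num_eq0 _ _ M). Qed.
Lemma to_local_ring0 : tau 0 = 0.
Proof. by apply/to_local_ring_eq0; exists 1; [exact: prime1|rewrite mulr0; exact: ideal0 (ideal_gen_ideal _)]. Qed.
Lemma to_local_ringN r : tau (- r) = - tau r.
Proof. by apply/eqP; rewrite -addr_eq0 -to_local_ringD addNr to_local_ring0. Qed.
Lemma to_local_ringB r s : tau (r - s) = tau r - tau s. Proof. by rewrite to_local_ringD to_local_ringN. Qed.

Lemma to_local_ring_unit s : ~ P s -> exists b, tau s * b = 1. Proof. exact: (@of_num_unit _ _ M). Qed.
Lemma to_local_ring_repr (a : A) : exists r s, ~ P s /\ a * tau s = tau r.
Proof. exact: (@of_num_repr _ _ M). Qed.

Lemma ideal_unitM (J : set A) a s : is_ideal J -> ~ P s -> J (a * tau s) -> J a.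
Proof.
move=> iJ /to_local_ring_unit[b sb] Ja; rewrite -(mulr1 a) -sb mulrA.
exact: idealMr.
Qed.

Definition contraction (J : set A) : set R := [set r | J (tau r)].

Lemma contraction_ideal (J : set A) : is_ideal J -> is_ideal (contraction J).
Proof.
move=> iJ; split; rewrite /contraction /=.
- by rewrite to_local_ring0; exact: ideal0.
- by move=> a b; rewrite to_local_ringD; exact: idealD.
- by move=> r a; rewrite to_local_ringM; exact: idealMl.
Qed.

Lemma contraction_sat (J : set A) r s :
  is_ideal J -> ~ P s -> contraction J (s * r) -> contraction J r.
Proof.
by move=> iJ Ps; rewrite /contraction /= mulrC to_local_ringM; exact: ideal_unitM.
Qed.

Lemma sub_contraction (J : set A) : is_ideal J -> G `<=` contraction J.
Proof.
move=> iJ a Ga; rewrite /contraction /=.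
have -> : tau a = 0; last exact: ideal0.
apply/to_local_ring_eq0; exists 1; first exact: prime1.
by rewrite mul1r; exact: ideal_gen_sub.
Qed.

(** A fraction and its numerator differ by a unit, so an ideal of the local ring is determined by
    its contraction. *)
Lemma contraction_inj (J L : set A) : is_ideal J -> is_ideal L ->
  contraction J `<=` contraction L -> J `<=` L.
Proof.
move=> iJ iL JL a Ja; have [r [s [Ps e]]] := to_local_ring_repr a.
apply: (ideal_unitM iL Ps); rewrite e; apply: JL.
by rewrite /contraction /= -e; exact: idealMr.
Qed.

Lemma contraction_prime (Q : spec A) : is_prime (contraction Q).
Proof.
split; first exact/contraction_ideal/primeI.
  by rewrite /contraction /= to_local_ring1; exact: prime1.
by move=> a b; rewrite /contraction /= to_local_ringM => /primeM.
Qed.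

Definition contract (Q : spec A) : spec R := Spec (contraction_prime Q).

Lemma contract_sub (Q : spec A) : contract Q `<=` P.
Proof.
move=> r Qr; apply: contrapT => /to_local_ring_unit[b] /prime_unit; apply; exact: Qr.
Qed.

Definition extension (I : set R) : set A :=
  [set a | exists r s, [/\ ~ P s, I r & a * tau s = tau r]].

Lemma extension_ideal I : is_ideal I -> is_ideal (extension I).
Proof.
move=> iI; split.
- by exists 0, 1; split; [exact: prime1|exact: ideal0|rewrite mul0r to_local_ring0].
- move=> a b [r [s [Ps Ir e]]] [r' [s' [Ps' Ir' e']]].
  exists (s' * r + s * r'), (s * s'); split; first exact: primeMn.
    by apply: idealD => //; exact: idealMl.
  by rewrite to_local_ringD !to_local_ringM -e -e'; ring.
- move=> a b [r [s [Ps Ir e]]]; have [r' [s' [Ps' e']]] := to_local_ring_repr a.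
  exists (r' * r), (s' * s); split; [exact: primeMn|exact: idealMl|].
  by rewrite !to_local_ringM -e -e'; ring.
Qed.

Lemma extension_to_local_ring I r : is_ideal I -> G `<=` I ->
  extension I (tau r) <-> exists2 s, ~ P s & I (s * r).
Proof.
move=> iI GI; split=> [[r' [s [Ps Ir']]]|[s Ps Isr]]; last first.
  by exists (s * r), s; split; rewrite // to_local_ringM mulrC.
rewrite -to_local_ringM => e; have /to_local_ring_eq0[t Pt It] : tau (r * s - r') = 0.
  by rewrite to_local_ringB e subrr.
exists (t * s); first exact: primeMn.
rewrite [X in I X](_ : _ = t * (r * s - r') + t * r'); last by ring.
by apply: idealD => //; [exact: (ideal_gen_min iI GI)|exact: idealMl].
Qed.

Section ExtendPrime.
Variables (Q : spec R) (GQ : G `<=` Q) (QP : Q `<=` P).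

Lemma extension_prime_to_local_ring r : extension Q (tau r) <-> Q r.
Proof.
split=> [/(extension_to_local_ring r (primeI Q) GQ)[s Ps /primeM[/QP|]//]|Qr].
by exists r, 1; split=> //; [exact: prime1|rewrite to_local_ring1 mulr1].
Qed.

Lemma extension_prime : is_prime (extension Q).
Proof.
have iQ := extension_ideal (primeI Q); split=> // [|a b].
  by rewrite -to_local_ring1 => /extension_prime_to_local_ring/prime1.
have [r [s [Ps e]]] := to_local_ring_repr a; have [r' [s' [Ps' e']]] := to_local_ring_repr b.
move=> Qab; have : extension Q (tau (r * r')).
  by rewrite to_local_ringM -e -e' mulrACA; exact: idealMr.
move=> /extension_prime_to_local_ring/primeM[] /extension_prime_to_local_ring.
  by rewrite -e => /(ideal_unitM iQ Ps); left.
by rewrite -e' => /(ideal_unitM iQ Ps'); right.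
Qed.

Definition extend : spec A := Spec extension_prime.

Lemma extend_to_local_ring r : extend (tau r) <-> Q r. Proof. exact: extension_prime_to_local_ring. Qed.
End ExtendPrime.

Lemma nonunitsE : @nonunits A = extension P.
Proof.
have ePt := extension_prime_to_local_ring GP (@subset_refl _ P).
have iP := extension_ideal (primeI P).
apply/seteqP; split=> a.
  have [r [s [Ps e]]] := to_local_ring_repr a => na.
  apply: (ideal_unitM iP Ps); rewrite e; apply/ePt.
  apply: contrapT => /to_local_ring_unit[b rb]; apply: na; exists (tau s * b).
  by rewrite mulrA e.
move=> Pa [b ab]; exact: (@prime_unit _ (extend GP (@subset_refl _ P)) _ _ ab Pa).
Qed.

Lemma nonunits_ideal : is_ideal (@nonunits A).
Proof. rewrite nonunitsE; exact/extension_ideal/primeI. Qed.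

Lemma nonunits_to_local_ring r : @nonunits A (tau r) <-> P r.
Proof. by rewrite nonunitsE; exact: extension_prime_to_local_ring. Qed.

(** This moves questions about generators from the local ring to [R], where generation is only up to
    multipliers outside [P]. *)
Lemma extension_gen (g : seq R) (J : set A) : is_ideal J -> [set` g] `<=` contraction J ->
  (forall r, contraction J r -> exists2 s, ~ P s & ideal_gen (G `|` [set` g]) (s * r)) ->
  J = ideal_gen [set` map tau g].
Proof.
move=> iJ gJ Jg; have ig := ideal_gen_ideal [set` map tau g].
apply/seteqP; split; last first.
  apply: ideal_gen_min => // _ /= /mapP[r gr ->]; exact: gJ.
apply: contraction_inj => // r /Jg[s Ps H].
apply: (contraction_sat ig Ps); move: H; apply: ideal_gen_min; first exact: contraction_ideal.
move=> a [Ga|/= ga]; first exact: sub_contraction.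
by apply: ideal_gen_sub; apply: map_f.
Qed.

Lemma local_ring_noetherian : noetherian R -> noetherian A.
Proof.
move=> noeth J iJ; have [g gJ] := noeth _ (contraction_ideal iJ).
exists (map tau g); apply: extension_gen => //; first by rewrite gJ; exact: ideal_gen_sub.
move=> r; rewrite gJ => gr; exists 1; first exact: prime1.
by rewrite mul1r; apply: ideal_genS gr => a; right.
Qed.

End LocalRingTheory.

(** Here the equations are all of the prime [Q], so [local_ring QP] is a localisation of the domain
    [R / Q]. *)
Lemma local_ring_domain (R : comNzRingType) (P Q : spec R) (QP : zeros Q P)
    (a b : local_ring QP) : a * b = 0 -> a = 0 \/ b = 0.
Proof.
have iQ := primeI Q.
have e0 r : to_local_ring QP r = 0 -> Q r.
  by move=> /to_local_ring_eq0[t Pt]; rewrite ideal_gen_id // => /primeM[/QP|].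
have e0' r : Q r -> to_local_ring QP r = 0.
  move=> Qr; apply/to_local_ring_eq0; exists 1; first exact: prime1.
  by rewrite ideal_gen_id // mul1r.
have z c s : ~ P s -> c * to_local_ring QP s = 0 -> c = 0.
  by move=> Ps; apply: (@ideal_unitM _ _ _ QP [set 0]) => //; split=> //= [_ _ -> ->|d _ ->];
    rewrite ?addr0 ?mulr0.
have [r [s [Ps e]]] := to_local_ring_repr a; have [r' [s' [Ps' e']]] := to_local_ring_repr b.
move=> ab; have /e0/primeM[] : to_local_ring QP (r * r') = 0.
  by rewrite to_local_ringM -e -e' mulrACA ab mul0r.
- by move=> /e0'; rewrite -e => /(z _ _ Ps); left.
- by move=> /e0'; rewrite -e' => /(z _ _ Ps'); right.
Qed.

(** If [x] is in [Q], then [Q] serves. Otherwise [Q] extends to a nonzero prime of the local domain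
    of [R / Q0] at [P] that avoids [x]. So some prime containing [x] is not maximal there, and its
    contraction lies strictly between [Q0] and [P]. *)
Lemma principal_ideal_theorem (R : comNzRingType) (Q0 Q P : spec R) x :
  noetherian R -> Q0 `<` Q -> Q `<` P -> P x ->
  exists Q' : spec R, [/\ Q0 `<` Q', Q' `<` P & Q' x].
Proof.
move=> noeth [Q0Q nQQ0] [QP nPQ] Px.
case: (pselect (Q x)) => [Qx|nQx]; first by exists Q.
have Q0P : zeros Q0 P by apply: subset_trans QP.
have [y Qy nQ0y] : exists2 y, Q y & ~ Q0 y.
  by apply: contrapT => nex; apply: nQQ0 => y Qy; apply: contrapT => nQ0y; apply: nex; exists y.
pose t := to_local_ring Q0P.
have [||||Q' [Q'x [b nb Q'b]]] := @nonminimal_over_principal _ (local_ring_noetherian (GP := Q0P) noeth)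
  (nonunits_ideal Q0P) (@local_ring_domain _ _ _ Q0P) (t x) (t y) (extend Q0P Q0Q QP).
- exact/nonunits_to_local_ring.
- by move/extend_to_local_ring.
- exact/extend_to_local_ring.
- move=> /to_local_ring_eq0[s Ps]; rewrite ideal_gen_id; last exact: primeI.
  by move=> /primeM[/Q0P|].
exists (contract Q'); split=> //.
  split; first exact: (sub_contraction (primeI Q')).
  by move=> /(_ x Q'x) /Q0Q.
split; first exact: contract_sub.
move=> PQ'; apply: Q'b; move: nb; apply: (contraction_inj (nonunits_ideal _) (primeI _)).
by move=> r /nonunits_to_local_ring /PQ'.
Qed.
(** * Heights and regularity at a prime *)

Lemma proper_subset_trans (T : Type) (A B C : set T) : A `<` B -> B `<=` C -> A `<` C.
Proof. by move=> [AB nBA] BC; split; [exact: subset_trans BC|move=> /(subset_trans BC)]. Qed.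

Section Chains.
Variable R : comNzRingType.
Implicit Types (P Q : spec R) (G H I : set R) (f : R) (g : seq R) (n : nat).

(** Says that the height of [P] modulo [G] is at least [n]: there are [n] strict inclusions
    descending from [P], and the last prime contains [G]. *)
Fixpoint chain_below G P n : Prop :=
  if n is n'.+1 then exists2 Q : spec R, Q `<` P & chain_below G Q n' else G `<=` P.

Lemma chain_below_sub G P n : chain_below G P n -> G `<=` P.
Proof.
by elim: n P => [//|n IHn] P [Q [QP _] /IHn GQ]; apply: subset_trans QP.
Qed.

Lemma chain_below_top G P Q n : Q `<=` P -> chain_below G Q n -> chain_below G P n.
Proof.
case: n => [|n] QP; first by move=> GQ; apply: subset_trans QP.
by move=> [Q' Q'Q chQ']; exists Q' => //; apply: proper_subset_trans QP.
Qed.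

Lemma chain_below_add G P Q n k :
  chain_below G P n -> (forall Q, G `<=` Q -> Q `<=` P -> chain_below set0 Q k) ->
  chain_below set0 P (n + k).
Proof.
elim: n P => [|n IHn] P; first by move=> GP h; exact: h.
move=> [Q' Q'P chQ'] h; exists Q' => //; apply: IHn => // Q'' GQ'' Q''Q'.
by apply: h => //; apply: subset_trans Q''Q' _; case: Q'P.
Qed.

Hypothesis noeth : noetherian R.

(** The element [f] is pushed down the chain: a prime just below [P] that omits [f] is exchanged for
    one that contains [f] and still lies above the next prime. Only the bottom of the chain is
    lost. *)
Lemma chain_below_cut G P n f :
  chain_below G P n.+1 -> P f -> chain_below (G `|` [set f]) P n.
Proof.
elim: n P => [|n IHn] P [Q QP chQ] Pf.
  by move=> a [/chQ|/= -> //]; case: QP => + _; apply.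
case: (pselect (Q f)) => [Qf|nQf]; first by exists Q => //; apply: IHn.
case: chQ => Q0 Q0Q chQ0.
have [Q' [Q0Q' Q'P Q'f]] := principal_ideal_theorem noeth Q0Q QP Pf.
by exists Q' => //; apply: IHn => //; exists Q0.
Qed.

Lemma chain_below_cuts G P n g :
  [set` g] `<=` P -> chain_below G P (n + size g) -> chain_below (G `|` [set` g]) P n.
Proof.
elim: g G => [|x g IHg] G gP; first by rewrite addn0 set_nil setU0.
rewrite set_cons [_ `|` [set x]]setUC setUA => ch; apply: IHg.
  by move=> a ga; apply: gP; rewrite /= inE [a \in g]ga orbT.
by apply: chain_below_cut; [move: ch; rewrite /= addnS|apply: gP; rewrite /= mem_head].
Qed.

(** The contraction to [R] of the ideal generated by [G] in the localisation of [R] at [P]. *)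
Definition saturation P G : set R := [set a | exists2 s, ~ P s & ideal_gen G (s * a)].

Lemma sub_saturation P G : ideal_gen G `<=` saturation P G.
Proof. by move=> a Ga; exists 1; [exact: prime1|rewrite mul1r]. Qed.

Lemma sub_saturation_gen P G : G `<=` saturation P G.
Proof. by move=> a Ga; apply: sub_saturation; exact: ideal_gen_sub. Qed.

Lemma saturation_ideal P G : is_ideal (saturation P G).
Proof.
have iG := ideal_gen_ideal G; split.
- by apply: sub_saturation; exact: ideal0.
- move=> a b [s Ps sa] [t Pt tb]; exists (s * t); first exact: primeMn.
  rewrite [X in ideal_gen _ X](_ : _ = t * (s * a) + s * (t * b)); last by ring.
  by apply: (idealD iG); exact: (idealMl _ iG).
- move=> r a [s Ps sa]; exists s => //.
  by rewrite mulrCA; exact: (idealMl _ iG).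
Qed.

Lemma saturationM P G s a : ~ P s -> saturation P G (s * a) -> saturation P G a.
Proof. by move=> Ps [t Pt]; rewrite mulrA; exists (t * s) => //; exact: primeMn. Qed.

Lemma saturation_min P G I : is_ideal I -> (forall s a, ~ P s -> I (s * a) -> I a) ->
  G `<=` I -> saturation P G `<=` I.
Proof. by move=> iI sI GI a [s Ps /(ideal_gen_min iI GI)]; exact: sI. Qed.

Lemma saturation_le P G H : G `<=` saturation P H -> saturation P G `<=` saturation P H.
Proof. by apply: saturation_min => [|s a]; [exact: saturation_ideal|exact: saturationM]. Qed.

Lemma saturationS P G H : G `<=` H -> saturation P G `<=` saturation P H.
Proof.
by move=> GH; apply: saturation_le; apply: subset_trans GH _; exact: sub_saturation_gen.
Qed.

Lemma saturation_prime P Q G : Q `<=` P -> G `<=` Q -> saturation P G `<=` Q.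
Proof.
move=> QP GQ; apply: saturation_min GQ; first exact: primeI.
by move=> s a Ps /primeM[/QP|].
Qed.

(** Krull's height theorem. Cutting a longer chain by all of [g] would leave a prime strictly below
    [P] that contains [G] and [g], hence contains [P]. *)
Lemma height_bound G P g n : [set` g] `<=` P -> P `<=` saturation P (G `|` [set` g]) ->
  chain_below G P n -> (n <= size g)%N.
Proof.
move=> gP Pg + ; rewrite leqNgt => ch; apply/negP => lt; move: ch.
have [k ->] : exists k, n = (k.+1 + size g)%N.
  by exists (n - (size g).+1)%N; rewrite addSnnS subnK.
move=> /(chain_below_cuts gP)[Q [QP nPQ] /chain_below_sub GgQ].
by apply: nPQ; apply: subset_trans Pg _; exact: saturation_prime.
Qed.

(** Products only; the ideal P^2 is [ideal_gen (square P)]. *)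
Definition square P : set R := [set a | exists p q, [/\ P p, P q & a = p * q]].

Lemma square_sub P : square P `<=` P.
Proof. by move=> _ [p [q [Pp _ ->]]]; apply: idealMr => //; exact: primeI. Qed.

(** Nakayama's lemma at [P], again by maximality: [L] is maximal among the saturated ideals above
    [G] that do not contain [P], and [b] is an element of [P] outside [L]. *)
Lemma Nakayama P G : P `<=` saturation P (G `|` square P) -> P `<=` saturation P G.
Proof.
move=> PG; apply: contrapT => nPG.
pose F L := [/\ is_ideal L, forall s a, ~ P s -> L (s * a) -> L a & ~ P `<=` L].
have [||L [[iL satL nPL] GL Lmax]] := @noetherian_max _ F (saturation P G) noeth.
- by move=> L [].
- by split=> [|s a|//]; [exact: saturation_ideal|exact: saturationM].
apply: nPL => b Pb; apply: contrapT => nLb.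
have hL : P `<=` saturation P (L `|` [set b]).
  apply: contrapT => nh; apply: nLb; apply: (Lmax (saturation P (L `|` [set b]))).
  - by split=> // [|s a]; [exact: saturation_ideal|exact: saturationM].
  - by move=> a La; apply: sub_saturation_gen; left.
  - by apply: sub_saturation_gen; right.
(* Up to denominators, [N] is [L + P b]. It contains P^2 because [P] lies in the saturation of
   [L + (b)]. Once [b] itself is in [N], the multiplier [s - p] is outside [P] and sends [b] into
   [L]. *)
pose N := [set q | exists s p, [/\ ~ P s, P p & L (s * q - p * b)]].
have iP := primeI P.
have subN : saturation P (G `|` square P) `<=` N.
  apply: saturation_min.
  - split.
    + by exists 1, 0; split; [exact: prime1|exact: ideal0|rewrite mulr0 mul0r subr0; exact: ideal0].
    + move=> q q' [s [p [Ps Pp Lq]]] [s' [p' [Ps' Pp' Lq']]].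
      exists (s * s'), (s' * p + s * p'); split; first exact: primeMn.
        by apply: idealD => //; exact: idealMl.
      rewrite [X in L X](_ : _ = s' * (s * q - p * b) + s * (s' * q' - p' * b)); last by ring.
      by apply: idealD => //; exact: idealMl.
    + move=> r q [s [p [Ps Pp Lq]]]; exists s, (r * p); split=> //; first exact: idealMl.
      by rewrite mulrCA -mulrA -mulrBr; exact: idealMl.
  - move=> t q Pt [s [p [Ps Pp Lq]]]; exists (s * t), p; split=> //; first exact: primeMn.
    by rewrite -mulrA.
  - move=> a [Ga|[p [q [Pp /hL[s Ps sq] ->]]]].
      exists 1, 0; split; [exact: prime1|exact: ideal0|].
      by rewrite mul1r mul0r subr0; apply: GL; exact: sub_saturation_gen.
    have [r] := ideal_genU1 sq; rewrite ideal_gen_id // => Lsq.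
    exists s, (p * r); split=> //; first exact: idealMr.
    by rewrite mulrCA -mulrA -mulrBr; exact: idealMl.
have [s [p [Ps Pp]]] := subN _ (PG _ Pb); rewrite -mulrBl => /satL h.
by apply/nLb/h => Psp; apply: Ps; rewrite -(subrK p s); exact: idealD.
Qed.

End Chains.

(** * Regularity of the local ring, read off in the ambient ring *)

Section Regularity.
Variables (R : comNzRingType) (noeth : noetherian R).
Implicit Types (P Q : spec R) (G H I Y : set R) (f : R) (g : seq R) (n : nat).

(** Contraction and extension match the primes of the local ring with the primes between [G] and
    [P]. A chain in the local ring may stop short of the maximal ideal, which [chain_below_top]
    repairs. *)
Lemma prime_chainP G P (GP : zeros G P) n :
  prime_chain (local_ring GP) n <-> chain_below G P n.
Proof.
split=> [[Q Qlt]|].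
  suff h i : (i < n.+1)%N -> chain_below G (contract (Q (inord i))) i.
    by move: (h n (ltnSn n)); apply: chain_below_top; exact: contract_sub.
  elim: i => [_|i IHi lti]; first exact: (sub_contraction (primeI _)).
  exists (contract (Q (inord i))); last exact/IHi/ltnW.
  have [|QQ nQQ] := Qlt (inord i) (inord i.+1); first by rewrite !inordK // ltnW.
  split; first by move=> r; exact: QQ.
  move=> h; apply: nQQ; apply: (contraction_inj (primeI _) (primeI _)); exact: h.
move=> ch; have [Q [Q0 Qn Qlt]] : exists Q : nat -> spec R,
    [/\ G `<=` Q 0%N, Q n = P & forall i, (i < n)%N -> Q i `<` Q i.+1].
  elim: n P {GP} ch => [|n IHn] P; first by exists (fun=> P).
  move=> [P' P'P /IHn[Q [Q0 Qn Qlt]]].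
  exists (fun i => if (i <= n)%N then Q i else P); split; rewrite ?leq0n ?ltnn // => i.
  rewrite ltnS; case: ltngtP => [lt _|//|-> _]; last by rewrite Qn.
  exact: Qlt.
have Qle i j : (i <= j)%N -> (j <= n)%N -> Q i `<=` Q j.
  elim: j => [|j IHj]; first by rewrite leqn0 => /eqP -> _ r.
  rewrite leq_eqVlt ltnS => /predU1P[-> _ r //|/IHj h lt].
  by apply: subset_trans (h (ltnW lt)) _; case: (Qlt _ lt).
have /choice[T TQ] : forall i : 'I_n.+1, exists T : spec (local_ring GP),
    forall r, T (to_local_ring GP r) <-> Q i r.
  move=> i; have [GQ QP] : G `<=` Q i /\ Q i `<=` P.
    split; first by apply: subset_trans Q0 (Qle _ _ (leq0n _) _); rewrite -ltnS.
    by rewrite -Qn; apply: Qle; rewrite // -ltnS.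
  by exists (extend GP GQ QP) => r; exact: extend_to_local_ring.
exists T => i j ltij.
have [QQ nQQ] : Q i `<` Q j.
  apply: proper_subset_trans (Qle i.+1 j ltij _); last by rewrite -ltnS.
  by apply: Qlt; apply: leq_trans ltij _; rewrite -ltnS.
split; last by move=> h; apply: nQQ => r /TQ /h /TQ.
by apply: (contraction_inj (primeI _) (primeI _)) => r /TQ /QQ /TQ.
Qed.

Lemma nonunits_genP G P (GP : zeros G P) n :
  (exists2 g : seq (local_ring GP), size g = n & @nonunits (local_ring GP) = ideal_gen [set` g])
  <-> (exists2 g, size g = n & [set` g] `<=` P /\ P `<=` saturation P (G `|` [set` g])).
Proof.
have iu := nonunits_ideal GP.
split=> [[g gn gu]|[g gn [gP Pg]]]; last first.
  exists (map (to_local_ring GP) g); first by rewrite size_map.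
  apply: extension_gen => // [a /gP/(nonunits_to_local_ring GP) //|r].
  by move=> /(nonunits_to_local_ring GP)/Pg.
have /choice[f fP] := to_local_ring_repr (GP := GP).
have gnu a : a \in g -> @nonunits (local_ring GP) a.
  by rewrite gu => ag; apply: ideal_gen_sub.
exists (map f g); first by rewrite size_map.
split=> [_ /= /mapP[a ga ->]|p].
  have [s [Ps e]] := fP a; apply/(nonunits_to_local_ring GP); rewrite -e.
  by apply: (idealMr _ iu); exact: gnu.
have iG := ideal_gen_ideal (G `|` [set` map f g]).
move=> /(nonunits_to_local_ring GP); rewrite gu => gp.
have GG : G `<=` ideal_gen (G `|` [set` map f g]) by move=> a Ga; apply: ideal_gen_sub; left.
apply/(extension_to_local_ring GP p iG GG).
move: gp; apply: ideal_gen_min; first exact: extension_ideal.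
move=> a /= ga; have [s [Ps e]] := fP a; exists (f a), s; split=> //.
by apply: ideal_gen_sub; right; exact: map_f.
Qed.

Lemma regular_atP G P (GP : zeros G P) : regular_at GP <->
  exists d, [/\ chain_below G P d, forall e, chain_below G P e -> (e <= d)%N &
    exists2 g, size g = d & [set` g] `<=` P /\ P `<=` saturation P (G `|` [set` g])].
Proof.
split=> [[_ _ [d [/prime_chainP chd dmax] /nonunits_genP hg]]|[d [chd dmax hg]]].
  by exists d; split=> // e /(prime_chainP GP); exact: dmax.
split; [exact: local_ring_noetherian|exact: nonunits_ideal|].
exists d; last exact/nonunits_genP.
by split=> [|e /prime_chainP]; [exact/prime_chainP|exact: dmax].
Qed.

(* In [s * f = b + q + c], q gathers the terms whose coefficient lies in P: they belong to
   P^2, so that some coefficient in c has to be invertible at P. *)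
Lemma exchange_step P G f Y g s b q c : [set` g] `<=` P ->
  ~ saturation P (G `|` square P) f -> ~ P s -> s * f = b + q + c ->
  ideal_gen G b -> ideal_gen (square P) q -> ideal_gen Y q -> ideal_gen [set` g] c ->
  exists g', [/\ size g = (size g').+1, [set` g'] `<=` [set` g] &
    [set` g] `<=` saturation P (G `|` [set f] `|` Y `|` [set` g'])].
Proof.
move=> + nf Ps; elim: g Y q c => [|x g IHg] Y q c gP e Gb sq Yq.
  rewrite set_nil => /ideal_gen0 c0; case: nf; exists s => //.
  by rewrite e c0 addr0 ideal_genU; exists b, q.
rewrite set_cons => /ideal_genU1[r gcr].
have gP' : [set` g] `<=` P by move=> a ga; apply: gP; rewrite set_cons; left.
have Px : P x by apply: gP; rewrite /= mem_head.
(* If [r] is in [P], the term [r * x] moves into [q], and [x] is kept and recorded in [Y]. Otherwise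
   [x] can be solved for and is the generator to drop. *)
case: (pselect (P r)) => Pr.
  have [||||||g' [sg g'g gg']] := IHg (Y `|` [set x]) (q + r * x) (c - r * x) => //.
  - by rewrite e; ring.
  - apply: (idealD (ideal_gen_ideal _)) => //.
    by apply: ideal_gen_sub; exists r, x.
  - rewrite ideal_genU; exists q, (r * x); split=> //.
    by apply/ideal_gen_principal; exists r.
  exists (x :: g'); split; first by rewrite /= sg.
    by rewrite set_cons => a [/g'g|]; [left|right].
  rewrite !set_cons => a [/gg'|/= ->].
    by apply: saturationS => {}a [[Ga|[Ya|xa]]|ga]; [left; left|left; right|right; right|right; left].
  by apply: sub_saturation_gen; right; right.
exists g; split=> //.
move=> a [ga|/= ->]; first by apply: sub_saturation_gen; right.
exists r => //; rewrite [X in ideal_gen _ X](_ : _ = s * f - b - q - (c - r * x)); last by rewrite e; ring.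
have i := ideal_gen_ideal (G `|` [set f] `|` Y `|` [set` g]).
apply: (idealB i); last by move: gcr; apply: ideal_genS => ? ?; right.
apply: (idealB i); last by move: Yq; apply: ideal_genS => ? ?; left; right.
apply: (idealB i); last by move: Gb; apply: ideal_genS => ? ?; do 3 left.
by apply: (idealMl _ i); apply: ideal_gen_sub; left; left; right.
Qed.

Lemma exchange P G f g : P f -> [set` g] `<=` P -> P `<=` saturation P (G `|` [set` g]) ->
  ~ saturation P (G `|` square P) f ->
  exists g', [/\ size g = (size g').+1, [set` g'] `<=` P &
    P `<=` saturation P (G `|` [set f] `|` [set` g'])].
Proof.
move=> Pf gP Pg nf; have [s Ps] := Pg _ Pf.
rewrite ideal_genU => -[b [c [Gb gc e]]].
have [|||g' [sg g'g gg']] := @exchange_step P G f set0 g s b 0 c gP nf Ps _ Gb _ _ gc.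
- by rewrite addr0.
- exact: ideal0 (ideal_gen_ideal _).
- exact: ideal0 (ideal_gen_ideal _).
exists g'; split=> //; first exact: subset_trans gP.
apply: subset_trans Pg _; apply: saturation_le => a [Ga|].
  by apply: sub_saturation_gen; left; left.
by rewrite -[G `|` [set f]]setU0; exact: gg'.
Qed.

(** Steinitz exchange in P/P^2 localised at [P]. Independence is stated stepwise: no member of [fs]
    lies in the span of the preceding ones. *)
Lemma exchanges P g fs : [set` g] `<=` P -> P `<=` saturation P [set` g] ->
  [set` fs] `<=` P ->
  (forall l1 f l2, fs = l1 ++ f :: l2 -> ~ saturation P ([set` l1] `|` square P) f) ->
  exists g', [/\ size g = (size fs + size g')%N, [set` g'] `<=` P &
    P `<=` saturation P ([set` fs] `|` [set` g'])].
Proof.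
move=> gP Pg; elim/last_ind: fs => [|fs f IHfs] fsP ind.
  by exists g; rewrite set_nil set0U.
have rE : [set` rcons fs f] = [set` fs] `|` [set f].
  by rewrite -cats1 set_cat set_cons set_nil set0U.
rewrite rE in fsP.
have [||g' [sg g'P Pg']] := IHfs.
- by move=> a fa; apply: fsP; left.
- by move=> l1 x l2 e; apply: (ind l1 x (rcons l2 f)); rewrite e rcons_cat.
have [||g'' [sg' g''P Pg'']] := @exchange P [set` fs] f g' _ g'P Pg'.
- by apply: fsP; right.
- by apply: (ind fs f [::]); rewrite cats1.
exists g''; split=> //; last by rewrite rE.
by rewrite sg sg' size_rcons addnS.
Qed.

(** After the exchange, [size g - size fs] elements generate [P] modulo [fs]. Cutting the chain of
    length [size g] by [fs] leaves a chain of exactly this length, and [height_bound] excludes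
    longer ones. *)
Lemma regular_at_of_independent fs P (fsP : zeros [set` fs] P) g :
  [set` g] `<=` P -> P `<=` saturation P [set` g] -> chain_below set0 P (size g) ->
  (forall l1 f l2, fs = l1 ++ f :: l2 -> ~ saturation P ([set` l1] `|` square P) f) ->
  regular_at fsP.
Proof.
move=> gP Pg ch ind; have [g' [sg g'P Pg']] := exchanges gP Pg fsP ind.
apply/regular_atP; exists (size g'); split; last by exists g'.
  by rewrite -[[set` fs]]set0U; apply: chain_below_cuts; rewrite // addnC -sg.
by move=> e; apply: height_bound.
Qed.

(** Were the local ring regular of dimension [d], then [fs] and [d] parameters would generate [P] at
    [P], since Nakayama makes [f] redundant. These are fewer than the height forced by the last
    hypothesis. *)
Lemma not_regular_at_of_dependent G fs f P (GP : zeros G P) :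
  G = [set` fs] `|` [set f] -> saturation P ([set` fs] `|` square P) f ->
  (forall d, chain_below G P d -> chain_below set0 P (d + (size fs).+1)) ->
  ~ regular_at GP.
Proof.
move=> GE fdep hch /regular_atP[d [/hch ch _ [g gd [gP Pg]]]].
have : (d + (size fs).+1 <= size (fs ++ g))%N.
  apply: (@height_bound _ noeth set0 P) ch.
    rewrite set_cat => a [fa|]; last exact: gP.
    by apply: GP; rewrite GE; left.
  rewrite set0U set_cat; apply: Nakayama => //; apply: subset_trans Pg _.
  apply: saturation_le; rewrite GE => a [[fa|/= ->]|ga].
  - by apply: sub_saturation_gen; left; left.
  - by move: fdep; apply: saturationS => b [fb|sb]; [left; left|right].
  - by apply: sub_saturation_gen; left; right.
by rewrite size_cat gd addnC leq_add2r ltnn.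
Qed.

End Regularity.
(** * Polynomial rings are regular *)

Section HilbertBasis.
Variables (A : comNzRingType) (noeth : noetherian A).
Implicit Types (J : set {poly A}) (s : seq {poly A}) (f : {poly A}).

(** The leading coefficients in degree [n] of Hilbert's proof; the size is only bounded, so that
    zero is included and the set is an ideal. *)
Let lc J n : set A := [set a | exists f, [/\ J f, (size f <= n.+1)%N & f`_n = a]].

Let lc_ideal J n : is_ideal J -> is_ideal (lc J n).
Proof.
move=> iJ; split.
- by exists 0; rewrite size_poly0 coef0; split=> //; exact: ideal0.
- move=> _ _ [f [Jf sf <-]] [g [Jg sg <-]]; exists (f + g); rewrite coefD; split=> //.
    exact: idealD.
  by apply: leq_trans (size_polyD _ _) _; rewrite geq_max sf.
- move=> r _ [f [Jf sf <-]]; exists (r *: f); rewrite coefZ; split=> //.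
    by rewrite -mul_polyC; exact: idealMl.
  exact: leq_trans (size_scale_leq _ _) sf.
Qed.

Let lcS J n k : is_ideal J -> lc J n `<=` lc J (n + k).
Proof.
move=> iJ _ [f [Jf sf <-]]; exists (f * 'X^k); split; first exact: idealMr.
  by apply: leq_trans (size_polyMleq _ _) _; rewrite size_polyXn addnS /= -addSn leq_add2r.
by rewrite coefMXn ltnNge leq_addl addnK.
Qed.

Let lc_fin J n : is_ideal J ->
  exists2 s : seq {poly A}, [set` s] `<=` J & lc J n `<=` lc (ideal_gen [set` s]) n.
Proof.
move=> iJ; have [g gE] := noeth (lc_ideal n iJ).
have [s [sJ sg]] : exists s : seq {poly A}, [set` s] `<=` J /\ [set` g] `<=` lc (ideal_gen [set` s]) n.
  have: [set` g] `<=` lc J n by rewrite gE; exact: ideal_gen_sub.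
  elim: {gE}g => [|a g IHg]; first by exists [::].
  rewrite set_cons => gJ; have [|s [sJ sg]] := IHg.
    by move=> b gb; apply: gJ; left.
  have [|f [Jf sf fa]] := gJ a; first by right.
  exists (f :: s); rewrite set_cons; split=> [b [/sJ|/= ->]//|b [/sg|/= ->]].
    move=> [h [sh shn <-]]; exists h; split=> //.
    by move: sh; apply: ideal_genS => ? ?; left.
  by exists f; split=> //; apply: ideal_gen_sub; right.
exists s => //; rewrite {1}gE; apply: ideal_gen_min => //.
exact/lc_ideal/ideal_gen_ideal.
Qed.

(** The ideals [lc J n] increase with [n] and reach a maximal one at some [N]. Finitely many
    polynomials account for the degrees up to [N]; their multiples by powers of ['X] account for the
    higher ones. *)
Lemma poly_noetherian : noetherian {poly A}.
Proof.
move=> J iJ.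
have [||L [[N ->] _ Lmax]] := @noetherian_max _ (fun L => exists n, L = lc J n) (lc J 0) noeth.
- by move=> _ [n ->]; exact: lc_ideal.
- by exists 0%N.
have [s sJ sN] : exists2 s : seq {poly A}, [set` s] `<=` J &
    forall n, (n <= N)%N -> lc J n `<=` lc (ideal_gen [set` s]) n.
  elim: (N) => [|M [s sJ sM]].
    by have [s sJ s0] := lc_fin 0 iJ; exists s => // n; rewrite leqn0 => /eqP ->.
  have [t tJ tM] := lc_fin M.+1 iJ.
  have mono (u v : seq {poly A}) n : [set` u] `<=` [set` v] ->
      lc (ideal_gen [set` u]) n `<=` lc (ideal_gen [set` v]) n.
    by move=> uv a [f [uf sf fa]]; exists f; split=> //; apply: ideal_genS uf.
  exists (s ++ t) => [|n]; first by rewrite set_cat => f [/sJ|/tJ].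
  rewrite leq_eqVlt ltnS => /predU1P[->|/sM h] a.
    by move=> /tM; apply: mono => f ft; rewrite set_cat; right.
  by move=> /h; apply: mono => f fs; rewrite set_cat; left.
have is_ := ideal_gen_ideal [set` s].
have sall n : lc J n `<=` lc (ideal_gen [set` s]) n.
  case: (leqP n N) => [/sN //|/ltnW le].
  rewrite -(subnKC le) => a Ja; apply: lcS => //; apply: sN => //.
  by apply: (Lmax (lc J (N + (n - N)))) => //; [exists (N + (n - N))%N|exact: lcS].
exists s; apply/seteqP; split; last exact: ideal_gen_min.
suff h n f : (size f <= n)%N -> J f -> ideal_gen [set` s] f by move=> f; exact: (h (size f)).
elim: n f => [|n IHn] f; first by rewrite leqn0 size_poly_eq0 => /eqP -> _; exact: ideal0 is_.
move=> sf Jf; have [|h [sh shn hf]] := sall n f`_n; first by exists f.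
rewrite -(subrK h f); apply: (idealD is_) => //; apply: IHn; last first.
  by apply: idealB => //; move: sh; apply: ideal_gen_min.
apply/leq_sizeP => j; rewrite coefB leq_eqVlt => /predU1P[<-|lt]; first by rewrite hf subrr.
by rewrite !nth_default ?subr0 //; [exact: leq_trans shn lt|exact: leq_trans sf lt].
Qed.

End HilbertBasis.

(** At each [P], a system of generators of the maximal ideal of the local ring that is no larger
    than the height of [P]; by [height_bound] the two numbers agree. *)
Definition regular_ring (A : comNzRingType) : Prop := noetherian A /\
  forall P : spec A, exists g, [/\ [set` g] `<=` P, P `<=` saturation P [set` g] &
    chain_below set0 P (size g)].

(** * Primes of a polynomial ring in one variable *)

Section PolyPrimes.
Variable A : comNzRingType.
Implicit Types (p q : spec A) (P : spec {poly A}) (f : {poly A}).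

Definition poly_ext_set p : set {poly A} := [set f | forall i, p f`_i].

(** Gauss's argument: modulo [p], the product of the lowest coefficients of [f] and [g] outside [p]
    is a coefficient of [f * g]. *)
Lemma poly_ext_prime p : is_prime (poly_ext_set p).
Proof.
have ip := primeI p; split.
- split=> [i|f g pf pg i|r f pf i]; rewrite ?coef0 ?coefD ?coefM; first exact: ideal0.
    exact: idealD.
  by apply: ideal_sum => // j _; apply: idealMl.
- by move=> /(_ 0%N); rewrite coef1; exact: prime1.
- move=> f g pfg; apply: contrapT => /not_orP[nf ng].
  have low h : ~ poly_ext_set p h -> exists2 i, ~ p h`_i & forall j, (j < i)%N -> p h`_j.
    move=> nh; have ex : exists i, ~~ `[< p h`_i >].
      apply: contrapT => nex; apply: nh => i; apply: contrapT => ni.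
      by apply: nex; exists i; apply/asboolPn.
    case: (ex_minnP ex) => m /asboolPn nm hm; exists m => // j ltj.
    by apply: contrapT => /asboolPn /hm; rewrite leqNgt ltj.
  have [i nfi fi] := low f nf; have [j ngj gj] := low g ng.
  have lti : (i < (i + j).+1)%N by rewrite ltnS leq_addr.
  have := pfg (i + j)%N; rewrite coefM (bigD1 (Ordinal lti)) //= addKn.
  move=> h; apply: (primeMn nfi ngj); rewrite -(idealDl _ ip); first exact: h.
  apply: ideal_sum => // k neq; case: (ltngtP k i) => [lt|gt|e].
  - by apply: idealMr => //; exact: fi.
  - apply: idealMl => //; apply: gj.
    by rewrite ltn_subLR ?ltn_add2r // -ltnS.
  - by case/eqP: neq; apply: val_inj.
Qed.

Definition poly_ext p : spec {poly A} := Spec (poly_ext_prime p).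

Lemma poly_restrict_prime P : is_prime [set a | P a%:P].
Proof.
have iP := primeI P; split; first split=> /=.
- by rewrite polyC0; exact: ideal0.
- by move=> a b; rewrite polyCD; exact: idealD.
- by move=> r a; rewrite polyCM; exact: idealMl.
- by rewrite /= polyC1; exact: prime1.
- by move=> a b /=; rewrite polyCM => /primeM.
Qed.

Definition poly_restrict P : spec A := Spec (poly_restrict_prime P).

Lemma poly_ext_restrict P : poly_ext (poly_restrict P) `<=` P.
Proof.
have iP := primeI P; move=> f Pf; rewrite -(coefK f) poly_def.
by apply: ideal_sum => // i _; rewrite -mul_polyC; apply: idealMr => //; exact: Pf.
Qed.

Lemma poly_ext_proper p q : p `<` q -> poly_ext p `<` poly_ext q.
Proof.
move=> [pq nqp]; split=> [f pf i|h]; first exact/pq/pf.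
apply: nqp => a qa; have := h a%:P; rewrite /poly_ext_set /= => /(_ _ 0%N).
rewrite coefC eqxx; apply => i; rewrite coefC; case: eqP => // _.
exact: ideal0 (primeI _).
Qed.

Lemma poly_ext_chain p n : chain_below set0 p n -> chain_below set0 (poly_ext p) n.
Proof.
elim: n p => [p _ a //|n IHn p [q qp /IHn chq]].
by exists (poly_ext q) => //; exact: poly_ext_proper.
Qed.

Lemma poly_ext_gen P (g : seq A) : poly_restrict P `<=` saturation (poly_restrict P) [set` g] ->
  poly_ext (poly_restrict P) `<=` saturation P [set` map polyC g].
Proof.
move=> pg f pf; have iS := saturation_ideal P [set` map polyC g].
rewrite -(coefK f) poly_def; apply: (ideal_sum _ iS) => // i _; rewrite -mul_polyC.
apply: (idealMr _ iS); have [s Ps gs] := pg _ (pf i); exists s%:P => //.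
rewrite -polyCM; have ig := ideal_gen_ideal [set` map (@polyC A) g].
suff: ideal_gen [set` g] `<=` [set a | ideal_gen [set` map polyC g] a%:P] by apply.
apply: ideal_gen_min; last by move=> a ga; apply: ideal_gen_sub; exact: map_f.
split=> /= [|a b|r a]; first exact: ideal0 ig.
  by rewrite polyCD; exact: (idealD ig).
by rewrite polyCM; exact: (idealMl _ ig).
Qed.

(* A polynomial of least degree in P outside the extension p[X] of p = P /\ A has its
   leading coefficient outside p, so that dividing by it is possible up to denominators. *)
Lemma poly_prime_cases P : poly_ext (poly_restrict P) = P \/
  exists f, [/\ P f, poly_ext (poly_restrict P) `<` P &
    P `<=` saturation P (poly_ext (poly_restrict P) `|` [set f])].
Proof.
have iP := primeI P; set E := poly_ext _; have EP := @poly_ext_restrict P.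
case: (pselect (P `<=` E)) => [PE|nPE].
  by left; apply: spec_inj; apply/seteqP; split.
right; have ex : exists n, `[< exists f, [/\ P f, ~ E f & size f = n] >].
  apply: contrapT => nex; apply: nPE => f Pf; apply: contrapT => nEf.
  by apply: nex; exists (size f); apply/asboolP; exists f.
case: (ex_minnP ex) => n /asboolP[f [Pf nEf fn]] nmin.
have {}nmin h : P h -> (size h < n)%N -> E h.
  move=> Ph; rewrite ltnNge => /negP lt; apply: contrapT => nEh; apply: lt.
  by apply: nmin; apply/asboolP; exists h.
exists f; split=> //.
(* Otherwise the leading term lies in [E], and removing it leaves a shorter member of [P], which is
   in [E] by minimality; so [f] would be in [E]. *)
have nc : ~ P (lead_coef f)%:P.
  move=> Pc; apply: (nEf); rewrite -(subrK (lead_coef f *: 'X^(n.-1)) f).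
  have Ec : E (lead_coef f *: 'X^(n.-1)).
    by move=> i; rewrite coefZ; exact: (idealMr _ (primeI (poly_restrict P)) Pc).
  apply: (idealD (primeI E)) => //.
  apply: nmin; first by apply: idealB => //; exact: EP.
  have n0 : (0 < n)%N.
    rewrite -fn size_poly_gt0; apply/eqP => f0; apply: nEf; rewrite f0.
    exact: ideal0 (primeI _).
  rewrite -[X in (_ < X)%N](prednK n0) ltnS; apply/leq_sizeP => j.
  rewrite coefB coefZ coefXn lead_coefE fn leq_eqVlt => /predU1P[<-|lt].
    by rewrite eqxx mulr1 subrr.
  rewrite gtn_eqF // mulr0 subr0 nth_default // fn.
  by rewrite -(prednK n0).
have iS := saturation_ideal P (E `|` [set f]).
suff h k (q : {poly A}) : (size q <= k)%N -> P q -> saturation P (E `|` [set f]) q.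
  by move=> q; exact: (h (size q)).
elim: k q => [|k IHk] q.
  by rewrite leqn0 size_poly_eq0 => /eqP -> _; exact: ideal0 iS.
move=> sq Pq; case: (ltnP (size q) n) => [lt|le].
  by apply: sub_saturation_gen; left; exact: nmin.
apply: (saturationM nc); set c := lead_coef f in nc *.
(* One step of pseudo-division: [f] has degree [n.-1], so the shift brings its leading term to
   degree [k], where [r] cancels the coefficient of [c%:P * q]. *)
pose r := (q`_k *: 'X^(k.+1 - n)) * f.
have Sr : saturation P (E `|` [set f]) r.
  by apply: (idealMl _ iS); apply: sub_saturation_gen; right.
rewrite -(subrK r (_ * q)); apply: (idealD iS) => //; apply: IHk; last first.
  by apply: idealB => //; exact: idealMl.
have n0 : (0 < n)%N.
  rewrite -fn size_poly_gt0; apply/eqP => f0; apply: nEf; rewrite f0.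
  exact: ideal0 (primeI _).
apply/leq_sizeP => j; rewrite /r -scalerAl coefB coefCM coefZ mulrC [_ * f]mulrC coefMXn.
have nk : (n <= k.+1)%N := leq_trans le sq.
rewrite leq_eqVlt => /predU1P[<-|lt].
  have -> : (k < k.+1 - n)%N = false.
    by apply/negbTE; rewrite -leqNgt leq_subLR; case: (n) n0 => // n' _; rewrite addSn ltnS leq_addl.
  have -> : (k - (k.+1 - n))%N = n.-1.
    by case: (n) n0 nk => // n' _ nk; rewrite subSS subKn.
  by rewrite /c lead_coefE fn subrr.
rewrite (nth_default _ (leq_trans sq lt)) mul0r sub0r.
case: ltnP => _; first by rewrite mulr0 oppr0.
rewrite [f`_ _]nth_default ?mulr0 ?oppr0 // fn.
by rewrite leq_subRL ?(leq_trans (leq_subr _ _) lt) // subnK.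
Qed.

(** Over its restriction to [A], a prime either is the extended prime, with the same generators and
    height, or has one more generator [f] and one more step in the chain. *)
Lemma poly_regular_ring : regular_ring A -> regular_ring {poly A}.
Proof.
move=> [noeth reg]; split; first exact: poly_noetherian.
move=> P; have [g [gp pg chp]] := reg (poly_restrict P).
have gP : [set` map polyC g] `<=` P by move=> _ /= /mapP[a /gp ga ->].
have ch := poly_ext_chain chp.
have [e|[f [Pf EP Pf']]] := poly_prime_cases P.
  exists (map polyC g); split=> //; last by rewrite size_map -{1}e.
  by rewrite -{1}e; exact: poly_ext_gen.
exists (f :: map polyC g); split; rewrite ?set_cons.
- by move=> a [/gP|/= ->].
- apply: subset_trans Pf' _; apply: saturation_le => a [Ea|].
    by apply: saturationS (poly_ext_gen pg Ea) => ?; left.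
  by move=> ->; apply: sub_saturation_gen; right.
- by exists (poly_ext (poly_restrict P)); rewrite // size_map.
Qed.
End PolyPrimes.

Section Transfer.
Variables (A B : comNzRingType).

Lemma preim_prime (phi : {rmorphism A -> B}) (P : spec B) : is_prime [set a | P (phi a)].
Proof.
have iP := primeI P; split; first split=> /=.
- by rewrite rmorph0; exact: ideal0.
- by move=> a b; rewrite rmorphD; exact: idealD.
- by move=> r a; rewrite rmorphM; exact: idealMl.
- by rewrite /= rmorph1; exact: prime1.
- by move=> a b /=; rewrite rmorphM => /primeM.
Qed.

Definition preim_spec (phi : {rmorphism A -> B}) (P : spec B) : spec A :=
  Spec (preim_prime phi P).

Lemma ideal_gen_image (phi : {rmorphism A -> B}) (G : set A) a :
  ideal_gen G a -> ideal_gen (phi @` G) (phi a).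
Proof.
have i := ideal_gen_ideal (phi @` G).
suff: ideal_gen G `<=` [set a | ideal_gen (phi @` G) (phi a)] by apply.
apply: ideal_gen_min; last by move=> b Gb; apply: ideal_gen_sub; exists b.
split=> /= [|b c|r b]; first by rewrite rmorph0; exact: ideal0 i.
  by rewrite rmorphD; exact: (idealD i).
by rewrite rmorphM; exact: (idealMl _ i).
Qed.

Lemma image_seq (phi : A -> B) (g : seq A) : phi @` [set` g] = [set` map phi g].
Proof.
apply/seteqP; split=> [_ [a ga <-]|_ /= /mapP[a ga ->]]; first exact: map_f.
by exists a.
Qed.

End Transfer.

Lemma iso_regular_ring (A B : comNzRingType) (phi : {rmorphism A -> B})
    (psi : {rmorphism B -> A}) :
  cancel phi psi -> cancel psi phi -> regular_ring A -> regular_ring B.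
Proof.
move=> phiK psiK [noeth reg]; split=> [J iJ|P].
  have iJ' : is_ideal [set a | J (phi a)].
    split=> /= [|a b|r a]; first by rewrite rmorph0; exact: ideal0.
      by rewrite rmorphD; exact: idealD.
    by rewrite rmorphM; exact: idealMl.
  have [g gE] := noeth _ iJ'; exists (map phi g); apply/seteqP; split=> [b Jb|].
    rewrite -image_seq -(psiK b); apply: ideal_gen_image; rewrite -gE /=.
    by rewrite psiK.
  apply: ideal_gen_min => // _ /= /mapP[a ga ->].
  have : [set a | J (phi a)] a by rewrite gE; exact: ideal_gen_sub.
  by [].
have [g [gP Pg ch]] := reg (preim_spec phi P); exists (map phi g); split.
- by move=> _ /= /mapP[a /gP Pa ->].
- move=> b; rewrite -(psiK b) => /Pg[s Ps]; exists (phi s) => //.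
  by rewrite -rmorphM -image_seq; exact: ideal_gen_image.
rewrite size_map; move: (size g) ch => n {g gP Pg}.
elim: n P => [P _ a //|n IHn P [Q [QP nPQ] chQ]].
have e : preim_spec phi (preim_spec psi Q) = Q.
  by apply: spec_inj; apply/seteqP; split=> a /=; rewrite phiK.
exists (preim_spec psi Q); last by apply: IHn; rewrite e.
split=> [b /QP /=|h]; first by rewrite psiK.
by apply: nPQ => a /h /=; rewrite phiK.
Qed.

(** Invertibility is a hypothesis on a ring because the lemma serves for polynomials in zero
    variables. *)
Lemma field_regular_ring (A : comNzRingType) :
  (forall a : A, a = 0 \/ exists b, a * b = 1) -> regular_ring A.
Proof.
move=> Af; have z (P : set A) a : is_ideal P -> ~ P 1 -> P a -> a = 0.
  move=> iP nP Pa; case: (Af a) => // -[b ab]; case: nP.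
  by rewrite -ab; exact: idealMr.
split=> [J iJ|P].
  case: (pselect (J 1)) => [J1|nJ1].
    exists [:: 1]; have i := ideal_gen_ideal [set` [:: 1 : A]].
    apply/seteqP; split=> a _; rewrite -(mulr1 a).
      by apply: (idealMl _ i); apply: ideal_gen_sub; rewrite /= mem_head.
    exact: idealMl.
  exists [::]; rewrite set_nil; apply/seteqP; split=> a.
    by move=> /(z _ _ iJ nJ1) ->; exact: ideal0 (ideal_gen_ideal _).
  by move=> /ideal_gen0 ->; exact: ideal0.
exists [::]; rewrite set_nil; split=> // a /(z _ _ (primeI P) (@prime1 _ P)) ->.
exact: ideal0 (saturation_ideal _ _).
Qed.

(** * Regularity of polynomial rings in several variables *)

Section MPoly.
Variables (k : fieldType).

Lemma mpoly_rmorphism_ext n (S : comNzRingType) (f g : {rmorphism {mpoly k[n]} -> S}) :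
  (forall c, f c%:MP = g c%:MP) -> (forall i, f 'X_i = g 'X_i) -> f =1 g.
Proof.
move=> fgC fgX p; rewrite (mpolyE p) !rmorph_sum /=; apply: eq_bigr => m _.
rewrite -mul_mpolyC !rmorphM /= fgC; congr (_ * _).
rewrite mpolyXE_id !rmorph_prod /=; apply: eq_bigr => i _.
by rewrite !rmorphXn /= fgX.
Qed.

(** The inverse of [muni], written so that it is visibly a ring morphism. *)
Definition of_uni n : {poly {mpoly k[n]}} -> {mpoly k[n.+1]} :=
  horner_eval 'X_ord_max \o map_poly (@mwiden n k).

HB.instance Definition _ n := GRing.RMorphism.on (@of_uni n).

Lemma of_uniC n (p : {mpoly k[n]}) : of_uni p%:P = mwiden p.
Proof. by rewrite /of_uni /= /horner_eval map_polyC hornerC. Qed.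

Lemma of_uniX n : of_uni ('X : {poly {mpoly k[n]}}) = 'X_ord_max.
Proof. by rewrite /of_uni /= /horner_eval map_polyX hornerX. Qed.

Lemma muni_widen n (i : 'I_n) : muni ('X_(widen_ord (leqnSn n) i) : {mpoly k[n.+1]}) = ('X_i)%:P.
Proof.
rewrite muniE msuppX big_seq1 mcoeffX eqxx scale1r.
have -> : [multinom U_(widen_ord (leqnSn n) i)%MM (widen_ord (leqnSn n) j) | j < n] = U_(i)%MM.
  by apply/mnmP => j; rewrite mnmE !mnm1E -val_eqE.
rewrite mnm1E -val_eqE /= (ltn_eqF (ltn_ord i)) expr0.
by rewrite -mul_polyC mulr1.
Qed.

Lemma muni_max n : muni ('X_ord_max : {mpoly k[n.+1]}) = 'X.
Proof.
rewrite muniE msuppX big_seq1 mcoeffX eqxx scale1r mnm1E eqxx expr1.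
have -> : [multinom U_(ord_max : 'I_n.+1)%MM (widen_ord (leqnSn n) j) | j < n] = 0%MM.
  by apply/mnmP => j; rewrite mnmE mnm1E mnm0E -val_eqE /= gtn_eqF.
by rewrite mpolyX0 scale1r.
Qed.

Lemma mwidenXU n (i : 'I_n) : mwiden ('X_i : {mpoly k[n]}) = 'X_(widen_ord (leqnSn n) i).
Proof. by rewrite mwidenX mnmwiden1. Qed.

Lemma muniK n : cancel (@muni n k) (@of_uni n).
Proof.
move=> p; apply: (@mpoly_rmorphism_ext n.+1 _ (@of_uni n \o @muni n k) idfun) => [c|i] /=.
  by rewrite muniC of_uniC mwidenC.
have [[j ->]|->] : (exists j, i = widen_ord (leqnSn n) j) \/ i = ord_max.
- case: (ltngtP i n) => [lt|gt|e]; last by right; apply: val_inj.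
    by left; exists (Ordinal lt); apply: val_inj.
  by move: (ltn_ord i); rewrite ltnS leqNgt gt.
- by rewrite muni_widen of_uniC mwidenXU.
- by rewrite muni_max of_uniX.
Qed.

Lemma of_uniK n : cancel (@of_uni n) (@muni n k).
Proof.
have h : @muni n k \o @mwiden n k =1 polyC.
  apply: (@mpoly_rmorphism_ext n _ (@muni n k \o @mwiden n k) polyC) => [c|i] /=.
    by rewrite mwidenC muniC.
  by rewrite mwidenXU muni_widen.
move=> p; rewrite -{2}(coefK p) -{1}(coefK p) !poly_def !rmorph_sum /=; apply: eq_bigr => i _.
rewrite -mul_polyC !rmorphM /= of_uniC !rmorphXn /= of_uniX muni_max.
by congr (_ * _); exact: h.
Qed.

Lemma mpoly_regular_ring n : regular_ring {mpoly k[n]}.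
Proof.
elim: n => [|n IHn].
  apply: field_regular_ring => p; rewrite (nvar0_mpolyC p).
  case: (eqVneq (p@_0%MM) 0) => [->|c0]; first by left.
  by right; exists (p@_0%MM)^-1%:MP; rewrite -mpolyCM divff.
exact: (iso_regular_ring (@of_uniK n) (@muniK n) (poly_regular_ring IHn)).
Qed.
End MPoly.

(** * Making one variable free in a prime *)

Section MPolySpecialise.
Variables (k : fieldType) (n : nat).
Implicit Types (Q : spec {mpoly k[n]}) (p : {mpoly k[n]}) (i j : 'I_n).

(** Expansion in powers of ['X_i]. The coefficients stay in the ring with all variables, where
    ['X_i] does not occur in them, so that no renumbering arises. *)
Definition uni_in i : {mpoly k[n]} -> {poly {mpoly k[n]}} :=
  mmap (@polyC {mpoly k[n]} \o @mpolyC n k) (fun j => if j == i then 'X else ('X_j)%:P).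

HB.instance Definition _ i := GRing.RMorphism.on (uni_in i).

Lemma uni_inC i c : uni_in i c%:MP = (c%:MP)%:P.
Proof. by rewrite /uni_in mmapC. Qed.

Lemma uni_inX i j : uni_in i 'X_j = if j == i then 'X else ('X_j)%:P.
Proof. by rewrite /uni_in mmapX mmap1U. Qed.

Lemma uni_in0 i : uni_in i 0 = 0. Proof. exact: rmorph0. Qed.
Lemma uni_in1 i : uni_in i 1 = 1. Proof. exact: rmorph1. Qed.
Lemma uni_inB i p q : uni_in i (p - q) = uni_in i p - uni_in i q. Proof. exact: rmorphB. Qed.
Lemma uni_inM i p q : uni_in i (p * q) = uni_in i p * uni_in i q. Proof. exact: rmorphM. Qed.

Lemma uni_inK i p : (uni_in i p).['X_i] = p.
Proof.
apply: (@mpoly_rmorphism_ext _ _ _ (horner_eval 'X_i \o uni_in i) idfun) => [c|j] /=.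
  by rewrite uni_inC /horner_eval hornerC.
by rewrite uni_inX /horner_eval; case: eqP => [->|_]; rewrite ?hornerX ?hornerC.
Qed.

(* The prime generated by the elements of Q in which 'X_i does not occur. *)
Definition generic_in i Q : spec {mpoly k[n]} := preim_spec (uni_in i) (poly_ext Q).

Lemma generic_in_coef i Q p m : generic_in i Q p -> Q (uni_in i p)`_m.
Proof. exact. Qed.

Lemma generic_in_sub i Q : generic_in i Q `<=` Q.
Proof.
move=> p Qp; rewrite -(uni_inK i p) horner_coef; have iQ := primeI Q.
by apply: ideal_sum => // j _; apply: idealMr => //; exact: Qp.
Qed.

Lemma generic_in_free i Q p : uni_in i p = p%:P -> Q p -> generic_in i Q p.
Proof.
move=> e Qp m; change (Q (uni_in i p)`_m); rewrite e coefC; case: eqP => // _; exact: ideal0 (primeI Q).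
Qed.

End MPolySpecialise.

(** * Continuants *)

Section Continuants.
Variable R : comNzRingType.
Implicit Types (z : nat -> R) (P : spec R).

Lemma continuantSS z n :
  continuant z n.+2 = z n.+2 * continuant z n.+1 - continuant z n.
Proof. by []. Qed.

Lemma continuantS z n : continuant z n.+1 =
  z n.+1 * continuant z n - (if n is n'.+1 then continuant z n' else 0).
Proof. by case: n => //=; rewrite mulr1 subr0. Qed.

Lemma nat_ind2 (p : nat -> Prop) : p 0%N -> p 1%N -> (forall n, p n -> p n.+1 -> p n.+2) ->
  forall n, p n.
Proof.
move=> p0 p1 pS n; suff [] : p n /\ p n.+1 by [].
by elim: n => [//|n [pn pn1]]; split=> //; exact: pS.
Qed.

Lemma continuant_comaximal P z n : P (continuant z n) -> P (continuant z n.+1) -> False.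
Proof.
have iP := primeI P; elim: n => [/prime1 //|n IHn] Pn1.
rewrite continuantSS => Pn2; apply: IHn => //.
rewrite -(subKr (z n.+2 * continuant z n.+1) (continuant z n)).
by apply: idealB => //; exact: idealMl.
Qed.

(** All monomials of a continuant have the parity of [n], so none is constant when [n] is odd. *)
Lemma continuant_odd P z n : odd n -> (forall i, (0 < i <= n)%N -> P (z i)) ->
  P (continuant z n).
Proof.
have iP := primeI P; elim/nat_ind2: n => [//|_ Pz|n IHn _]; first exact: Pz.
rewrite /= negbK => on Pz; rewrite -/(continuant z n.+2) continuantSS; apply: idealB => //.
  by apply: idealMr => //; apply: Pz; rewrite ltnSn.
by apply: IHn => // i /andP[i0 le]; apply: Pz; rewrite i0 (leq_trans le) // -addn2 leq_addr.
Qed.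

(** For even [n] there are no linear terms, so only the constant term survives modulo P^2; the
    recursion flips its sign every two steps. *)
Lemma continuant_even P z n : ~~ odd n -> (forall i, (0 < i <= n)%N -> P (z i)) ->
  ideal_gen (square P) (continuant z n - (-1) ^+ n./2).
Proof.
have i2 := ideal_gen_ideal (square P).
elim/nat_ind2: n => [_ _|//|n IHn _]; first by rewrite subrr; exact: ideal0 i2.
move=> en Pz; have {}en : ~~ odd n by move: en; rewrite /= negbK.
have le i : (i <= n -> i <= n.+2)%N by move=> h; rewrite (leq_trans h) // -addn2 leq_addr.
rewrite continuantSS (_ : n.+2./2 = n./2.+1) // exprS.
rewrite [X in ideal_gen _ X](_ : _ = z n.+2 * continuant z n.+1 -
  (continuant z n - (-1) ^+ n./2)); last by ring.
apply: (idealB i2); last first.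
  by apply: IHn => // i /andP[i0 h]; apply: Pz; rewrite i0 le.
apply: ideal_gen_sub; exists (z n.+2), (continuant z n.+1); split=> //.
  by apply: Pz; rewrite ltnSn.
by apply: continuant_odd => // i /andP[i0 h]; apply: Pz; rewrite i0 leqW.
Qed.

Section Derivation.
Variables (z : nat -> R) (N : nat) (d : nat -> R -> R).
Hypotheses (dB : forall i, {morph d i : a b / a - b})
  (dM : forall i a b, d i (a * b) = d i a * b + a * d i b)
  (dz : forall i j, (0 < i <= N)%N -> (0 < j <= N)%N -> d i (z j) = (i == j)%:R).

Lemma derivation1 i : d i 1 = 0.
Proof.
by move: (dM i 1 1); rewrite !mulr1 mul1r => /eqP; rewrite -subr_eq0 opprD addNKr oppr_eq0 => /eqP.
Qed.

Lemma derivation_continuant_gt i n : (0 < i <= N)%N -> (n < i)%N -> d i (continuant z n) = 0.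
Proof.
move=> iN; have [i0 leN] := andP iN; elim/nat_ind2: n => [_|lt|n IHn IHn1 lt].
- exact: derivation1.
- by rewrite dz // ?gtn_eqF // (leq_trans _ leN) // ltnW.
- rewrite continuantSS dB dM IHn1 1?ltnW // IHn; last exact/ltnW/ltnW.
  rewrite dz //; last by rewrite (leq_trans _ leN) // ltnW.
  by rewrite gtn_eqF // mul0r mulr0 addr0 subr0.
Qed.

Lemma derivation_continuant_last n : (n < N)%N ->
  d n.+1 (continuant z n.+1) = continuant z n.
Proof.
move=> lt; rewrite continuantS dB dM dz // eqxx mul1r.
rewrite (@derivation_continuant_gt n.+1 n) // mulr0 addr0.
case: n lt => [|n] lt; last by rewrite derivation_continuant_gt // subr0.
by move: (dB 1%N 0 0); rewrite !subrr => ->; rewrite subr0.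
Qed.

(** The last derivative of P_(n+2) is P_(n+1), so P_n is outside [P]. The derivative by z_(n+1) is
    z_(n+2) P_n, which puts z_(n+2) into [P]. Modulo z_(n+2) the other derivatives are those of -
    P_n, and induction applies. The case of length one is excluded because the derivative is 1. *)
Lemma critical_continuant P n : (n <= N)%N ->
  (forall i, (0 < i <= n)%N -> P (d i (continuant z n))) ->
  ~~ odd n /\ forall i, (0 < i <= n)%N -> P (z i).
Proof.
have iP := primeI P.
elim/nat_ind2: n => [_ _|N1 /(_ 1%N isT)|n IHn _ ltN Pd].
- by split=> // i; rewrite leqn0 andbC => /andP[/eqP ->].
- by rewrite derivation_continuant_last => // /prime1.
have Pn1 : P (continuant z n.+1).
  by rewrite -derivation_continuant_last //; apply: Pd; rewrite ltnSn.
have Pn : ~ P (continuant z n) by move=> /continuant_comaximal; apply; exact: Pn1.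
have Pz2 : P (z n.+2).
  have := Pd n.+1; rewrite leqnSn => /(_ isT).
  rewrite continuantSS dB dM dz ?ltnSn ?(ltnW ltN) // eqn_leq ltnn andbF mul0r add0r.
  rewrite derivation_continuant_last 1?ltnW // derivation_continuant_gt ?(ltnW ltN) // subr0.
  by move=> /primeM[].
have [|i /andP[i0 le]|en Pz] := IHn; first by do 2 apply: ltnW.
  have lei : (i <= n.+2)%N by rewrite (leq_trans le) // -addn2 leq_addr.
  have := Pd i; rewrite i0 lei => /(_ isT); rewrite continuantSS dB dM.
  rewrite dz ?i0 ?(leq_trans lei) // ltn_eqF ?ltnS ?leqW // mul0r add0r => h.
  rewrite -(subKr (z n.+2 * d i (continuant z n.+1)) (d i (continuant z n))).
  by apply: idealB => //; exact: idealMr.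
split=> [|i]; first by rewrite /= negbK.
rewrite andbC => /andP[]; rewrite leq_eqVlt => /predU1P[-> //|].
rewrite ltnS leq_eqVlt => /predU1P[-> _|lt i0]; last by apply: Pz; rewrite i0.
(* P_(n+1) differs from this product by a continuant of odd length in variables from [P], or by zero
   when [n] is zero. *)
have : P (z n.+1 * continuant z n).
  move: Pn1; rewrite continuantS; case: n en Pz {IHn ltN Pd Pn Pz2} => [_ _|n en Pz].
    by rewrite subr0.
  rewrite idealDl //; apply: idealN => //; apply: continuant_odd.
    by move: en; rewrite /= negbK.
  by move=> j /andP[j0 le]; apply: Pz; rewrite j0 leqW.
by move=> /primeM[].
Qed.
End Derivation.
End Continuants.

(** * Independence modulo P^2 from independent differentials *)

Section Jacobian.
Variables (k : fieldType) (n : nat).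
Implicit Types (P : spec {mpoly k[n]}).

Lemma deriv_square P i p : ideal_gen (square P) p -> P (mderiv i p).
Proof.
have iP := primeI P.
suff h : ideal_gen (square P) `<=` [set p | P p /\ P (mderiv i p)] by move=> /h[].
apply: ideal_gen_min; last first.
  move=> _ [a [b [Pa Pb ->]]]; rewrite /= mderivM; split; first exact: idealMr.
  by apply: idealD => //; [exact: idealMl|exact: idealMr].
split=> /= [|a b [Pa da] [Pb db]|r a [Pa da]].
- by rewrite mderiv0; split; exact: ideal0.
- by rewrite mderivD; split; exact: idealD.
- rewrite mderivM; split; first exact: idealMl.
  by apply: idealD => //; exact: idealMl.
Qed.

Lemma ideal_gen_lincomb (R : comNzRingType) (T : finType) (phi : T -> R) (e : seq T) (G : set R) a :
  ideal_gen ([set` map phi e] `|` G) a -> exists2 r : T -> R,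
    forall j, j \notin e -> r j = 0 & ideal_gen G (a - \sum_j r j * phi j).
Proof.
elim: e a => [|x e IHe] a.
  rewrite set_nil set0U => Ga; exists (fun=> 0) => //.
  by rewrite big1 ?subr0 // => j _; rewrite mul0r.
rewrite /= set_cons -setUA [[set _] `|` _]setUC setUA => /ideal_genU1[c] /IHe[r re Gr].
exists (fun j => r j + (if j == x then c else 0)).
  by move=> j; rewrite inE negb_or => /andP[/negbTE -> /re ->]; rewrite addr0.
have -> : \sum_j (r j + (if j == x then c else 0)) * phi j = c * phi x + \sum_j r j * phi j.
  under eq_bigr do rewrite mulrDl; rewrite big_split /= addrC; congr (_ + _).
  by rewrite (bigD1 x) //= eqxx big1 ?addr0 // => j /negbTE ->; rewrite mul0r.
by rewrite opprD addrA.
Qed.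

(** Differentiating a relation modulo P^2 between elements of [P] gives one between their
    differentials modulo [P], whose coefficients are then in [P]; but one coefficient is the
    multiplier [s]. *)
Lemma jacobian_independent P (T : finType) (phi : T -> {mpoly k[n]}) (e : seq T) :
  uniq e -> (forall j, P (phi j)) ->
  (forall r : T -> {mpoly k[n]}, (forall i, P (\sum_j r j * mderiv i (phi j))) ->
    forall j, P (r j)) ->
  forall l1 f l2, map phi e = l1 ++ f :: l2 -> ~ saturation P ([set` l1] `|` square P) f.
Proof.
move=> ue Pphi jac l1 f l2 E; have iP := primeI P.
have [e1 [x [e2 [ee <- <-]]]] : exists e1 x e2, [/\ e = e1 ++ x :: e2, map phi e1 = l1 & phi x = f].
  have Et : map phi (take (size l1) e) = l1 by rewrite map_take E take_size_cat.
  have : map phi (drop (size l1) e) = f :: l2 by rewrite map_drop E drop_size_cat.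
  case Ed: (drop (size l1) e) => [|x e2] //= [fx _].
  by exists (take (size l1) e), x, e2; split=> //; rewrite -Ed cat_take_drop.
have xe1 : x \notin e1.
  by move: ue; rewrite ee cat_uniq /= => /and3P[_]; rewrite negb_or => /andP[].
move=> [s Ps] /ideal_gen_lincomb[r re].
pose r' j := (if j == x then s else 0) - r j.
have -> : s * phi x - \sum_j r j * phi j = \sum_j r' j * phi j.
  rewrite /r'; under [RHS]eq_bigr do rewrite mulrBl; rewrite sumrB; congr (_ - _).
  by rewrite (bigD1 x) //= eqxx big1 ?addr0 // => j /negbTE ->; rewrite mul0r.
move=> sq; apply: Ps; have : P (r' x); last by rewrite /r' eqxx re // subr0.
apply: jac => i; have := deriv_square i sq; rewrite raddf_sum /=.
under eq_bigr do rewrite mderivM; rewrite big_split /= addrC => h.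
by apply: (proj1 (idealDl _ iP _) h); apply: ideal_sum => // j _; exact: idealMl.
Qed.

End Jacobian.
(** * The codimension of the fiber *)

Section FiberTheory.
Variables (kappa : fieldType) (m : nat) (l : 'I_m -> nat).
Variables (lam : 'I_m -> kappa) (mu : kappa).
Notation R := (coord_ring kappa l).
Notation cont a n := (continuant (zseq kappa l a) n).
Notation var := (@Defs.var kappa m l).
Notation uvar := (Defs.uvar kappa l).
Notation wvar := (Defs.wvar kappa l).
Notation F := (Defs.F l lam).
Notation G := (Defs.G l mu).
Implicit Types (P Q : spec R) (a b c : 'I_m) (i j n : nat) (t : Defs.coord l) (f g : R).

Definition zcoord a i : Defs.coord l := inl (Tagged (fun a => 'I_(l a).+1) (inord i.-1 : 'I_(l a).+1)).

Lemma zseqE a i : zseq kappa l a i = var (zcoord a i). Proof. by []. Qed.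

Lemma zcoord_eq a i j : (0 < i <= (l a).+1)%N -> (0 < j <= (l a).+1)%N ->
  (zcoord a i == zcoord a j) = (i == j).
Proof.
move=> /andP[i0 il] /andP[j0 jl]; apply/eqP/eqP => [|-> //] [] /eqP.
rewrite eq_Tagged => /eqP/= /(congr1 val); rewrite /= !inordK ?prednK //.
by move=> e; rewrite -(prednK i0) -(prednK j0) e.
Qed.

Lemma zcoord_neq a b i j : a != b -> (zcoord a i == zcoord b j) = false.
Proof.
by move=> ab; apply/eqP => -[/eqP]; rewrite (negbTE ab).
Qed.

Section Generic.
Notation generic t := (generic_in (enum_rank t)).

Lemma uni_var t t' : uni_in (enum_rank t) (var t') = if t' == t then 'X else (var t')%:P.
Proof. by rewrite uni_inX (inj_eq enum_rank_inj). Qed.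

Definition free_of t f := uni_in (enum_rank t) f = f%:P.

Lemma free_var t t' : t' != t -> free_of t (var t').
Proof. by move=> /negbTE e; rewrite /free_of uni_var e. Qed.
Lemma free_C t x : free_of t (x%:MP : R). Proof. exact: uni_inC. Qed.
Lemma free_B t f g : free_of t f -> free_of t g -> free_of t (f - g).
Proof. by rewrite /free_of uni_inB => -> ->; rewrite polyCB. Qed.
Lemma free_M t f g : free_of t f -> free_of t g -> free_of t (f * g).
Proof. by rewrite /free_of uni_inM => -> ->; rewrite polyCM. Qed.
Lemma free_0 t : free_of t 0. Proof. by rewrite /free_of uni_in0 polyC0. Qed.
Lemma free_1 t : free_of t 1. Proof. by rewrite /free_of uni_in1 polyC1. Qed.
Lemma free_N t f : free_of t f -> free_of t (- f).
Proof. by rewrite -sub0r; apply: free_B; exact: free_0. Qed.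
Lemma free_D t f g : free_of t f -> free_of t g -> free_of t (f + g).
Proof. by move=> ff fg; rewrite -[g]opprK; apply: free_B => //; exact: free_N. Qed.
Lemma free_prod t (p : pred 'I_m) (f : 'I_m -> R) :
  (forall b, p b -> free_of t (f b)) -> free_of t (\prod_(b | p b) f b).
Proof.
by move=> fr; elim/big_ind: _ => //; [exact: free_1|move=> *; exact: free_M].
Qed.
Lemma free_continuant t a n : (forall i, (0 < i <= n)%N -> zcoord a i != t) ->
  free_of t (cont a n).
Proof.
elim/nat_ind2: n => [_|h|n IHn IHn1 h]; first exact: free_1.
  by apply: free_var; exact: h.
rewrite continuantSS; apply: free_B.
  apply: free_M; first by apply: free_var; apply: h; rewrite ltnSn.
  by apply: IHn1 => i /andP[i0 le]; apply: h; rewrite i0 leqW.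
by apply: IHn => i /andP[i0 le]; apply: h; rewrite i0 (leq_trans le) // -addn2 leq_addr.
Qed.
Lemma free_continuant_other a b i n : b != a -> free_of (zcoord a i) (cont b n).
Proof. by move=> ab; apply: free_continuant => j _; rewrite zcoord_neq. Qed.
Lemma free_continuant_gt a i n : (n < i <= (l a).+1)%N -> free_of (zcoord a i) (cont a n).
Proof.
move=> /andP[lt le]; apply: free_continuant => j /andP[j0 jn].
by rewrite zcoord_eq ?j0 ?(leq_trans _ le) ?(leq_ltn_trans _ lt) ?ltn_eqF // ?(leq_ltn_trans jn) // (leq_trans jn) // ltnW.
Qed.
Lemma free_F a b i : b != a -> free_of (zcoord a i) (F b).
Proof.
move=> ab; apply: free_B; first exact: free_continuant_other.
by apply: free_M; [exact: free_C|exact: free_var].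
Qed.

Lemma generic_free t Q f : free_of t f -> Q f -> generic t Q f.
Proof. exact: generic_in_free. Qed.

(* The coefficient of z_{n+1} in the continuant P_{n+1} is P_n. *)
Lemma generic_continuant Q a n f : (n <= l a)%N -> free_of (zcoord a n.+1) f ->
  generic (zcoord a n.+1) Q (cont a n.+1 - f) -> Q (cont a n).
Proof.
move=> le fr /(@generic_in_coef _ _ _ _ _ 1%N); rewrite continuantS.
set q := (X in _ * _ - X - f); have frq : free_of (zcoord a n.+1) (q + f).
  apply: free_D => //; rewrite /q; case: n le {fr q} => [|n] le; first exact: free_0.
  by apply: free_continuant_gt; rewrite leqnSn.
have frc : free_of (zcoord a n.+1) (cont a n) by apply: free_continuant_gt; rewrite leqnn.
rewrite -addrA -opprD uni_inB uni_inM frq frc zseqE uni_var eqxx.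
by rewrite coefB coefMC coefX coefC mul1r subr0.
Qed.

(** A whole block is made free because the coefficient P_(l_a) of the last variable in F_a may lie
    in [Q]; it cannot lie in [generic_block a (l a) Q]. *)
Fixpoint generic_block a n Q : spec R :=
  if n is n'.+1 then generic (zcoord a n) (generic_block a n' Q) else Q.

Lemma generic_block_sub a n Q : generic_block a n Q `<=` Q.
Proof. by elim: n => //= n IHn; apply: subset_trans IHn; exact: generic_in_sub. Qed.

Lemma generic_block_free a n Q f :
  (forall i, (0 < i <= n)%N -> free_of (zcoord a i) f) -> Q f -> generic_block a n Q f.
Proof.
elim: n => //= n IHn fr Qf; apply: generic_free; first by apply: fr; rewrite ltnSn.
by apply: IHn => // i /andP[i0 le]; apply: fr; rewrite i0 leqW.
Qed.

Lemma generic_block_continuant a n Q : (n <= (l a).+1)%N -> ~ generic_block a n Q (cont a n).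
Proof.
elim: n => [_ /prime1 //|n IHn lt Qc]; apply: IHn; first exact: ltnW.
by apply: (generic_continuant lt (free_0 _)); rewrite subr0; exact: Qc.
Qed.

Lemma generic_block_F a Q : ~ generic_block a (l a).+1 Q (F a).
Proof.
move=> h; apply: (@generic_block_continuant a (l a) Q) => //.
apply: generic_continuant h => //.
by apply: free_M; [exact: free_C|exact: free_var].
Qed.

(** Freeing block [a] removes F_a from the prime and keeps the other F_b, in which this block does
    not occur. *)
Lemma chain_below_blocks (e : seq 'I_m) Q : uniq e -> (forall a, a \in e -> Q (F a)) ->
  chain_below set0 Q (size e).
Proof.
elim: e Q => [Q _ _ f //|a e IHe] Q /= /andP[ae ue] QF.
exists (generic_block a (l a).+1 Q).
  split; first exact: generic_block_sub.
  by move=> h; apply: (@generic_block_F a Q); apply: h; apply: QF; rewrite mem_head.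
apply: IHe => // b be; apply: generic_block_free; last by apply: QF; rewrite inE be orbT.
by move=> i _; apply: free_F; apply: contraNneq ae => <-.
Qed.

Lemma wvar_coord : wvar = var (inr true). Proof. by []. Qed.
Lemma uvar_coord : uvar = var (inr false). Proof. by []. Qed.

Lemma free_product t : (forall a i, zcoord a i != t) ->
  free_of t (\prod_(a < m) cont a (l a) + mu%:MP).
Proof.
move=> h; apply: free_D; last exact: free_C.
by apply: free_prod => a _; apply: free_continuant => i _; exact: h.
Qed.

(* The coefficient of w in G is u. *)
Lemma generic_G Q : generic (inr true) Q G -> Q uvar.
Proof.
move=> /(@generic_in_coef _ _ _ _ _ 1%N); rewrite /Defs.G -addrA -opprD.
rewrite uni_inB uni_inM free_product // uvar_coord wvar_coord !uni_var eqxx /=.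
by rewrite coefB coefCM coefX coefC mulr1 subr0.
Qed.

Lemma chain_below_X_u Q : X lam mu `<=` Q -> ~ Q uvar -> chain_below set0 Q m.+1.
Proof.
move=> XQ nu; exists (generic (inr true) Q).
  split; first exact: generic_in_sub.
  by move=> /(_ G (XQ _ (or_intror erefl))) /generic_G.
suff : chain_below set0 (generic (inr true) Q) (size (enum 'I_m)) by rewrite -cardE card_ord.
apply: chain_below_blocks; first exact: enum_uniq.
move=> a _; apply: generic_free; last by apply: XQ; left; exists a.
apply: free_B; first by apply: free_continuant.
by apply: free_M; [exact: free_C|exact: free_var].
Qed.

(** Freeing the last variable of block [a] suffices here, as its coefficient in F_a is outside [Q].
    That variable does not occur in G, which therefore remains available for the final step. *)
Lemma chain_below_tops (e : seq 'I_m) Q : uniq e -> Q G -> (forall a, a \in e -> Q (F a)) ->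
  (forall a, a \in e -> ~ Q (cont a (l a))) -> chain_below set0 Q (size e).+1.
Proof.
elim: e Q => [|a e IHe] Q.
  (* Freeing u first takes it out of the prime, so that its role as coefficient of w then excludes
     G; the two operations count as one strict step. *)
  move=> _ QG _ _; exists (generic (inr true) (generic (inr false) Q)) => //.
  split; first by do 2!apply: subset_trans (@generic_in_sub _ _ _ _) _.
  move=> /(_ _ QG) /generic_G /(@generic_in_coef _ _ _ _ _ 1%N).
  by rewrite uvar_coord uni_var eqxx coefX; exact: prime1.
move=> /andP[ae ue] QG QF Qc; set t := zcoord a (l a).+1.
have neq b : b \in e -> b != a by move=> be; apply: contraNneq ae => <-.
have ane b : b \in e -> b \in a :: e by rewrite inE orbC => ->.
exists (generic t Q).
  split; first exact: generic_in_sub.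
  move=> /(_ (F a) (QF _ (mem_head _ _))) h; apply: (Qc a (mem_head _ _)).
  apply: generic_continuant h => //.
  by apply: free_M; [exact: free_C|exact: free_var].
apply: IHe => // [|b be|b be].
- apply: generic_free QG; rewrite /Defs.G -addrA -opprD; apply: free_B.
    by apply: free_M; exact: free_var.
  apply: free_D; last exact: free_C.
  apply: free_prod => b _; case: (eqVneq b a) => [->|ba]; last exact: free_continuant_other.
  by apply: free_continuant_gt; rewrite ltnSn.
- by apply: generic_free; [exact/free_F/neq|exact/QF/ane].
- by move=> /generic_in_sub; exact/Qc/ane.
Qed.

Lemma chain_below_X_continuant Q : X lam mu `<=` Q -> (forall a, ~ Q (cont a (l a))) ->
  chain_below set0 Q m.+1.
Proof.
move=> XQ nc; suff : chain_below set0 Q (size (enum 'I_m)).+1 by rewrite -cardE card_ord.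
apply: chain_below_tops => //; first exact: enum_uniq.
  by apply: XQ; right.
by move=> a _; apply: XQ; left; exists a.
Qed.
End Generic.
End FiberTheory.
(** * The singular points *)

Lemma ideal_prod_congr (A : comNzRingType) (J : set A) (T : Type) (e : seq T) (x y : T -> A) :
  is_ideal J -> (forall t, J (x t - y t)) -> J (\prod_(t <- e) x t - \prod_(t <- e) y t).
Proof.
move=> iJ xy; elim: e => [|t e IHe]; first by rewrite !big_nil subrr; exact: ideal0.
rewrite !big_cons [X in J X](_ : _ = (x t - y t) * \prod_(j <- e) x j +
  y t * (\prod_(j <- e) x j - \prod_(j <- e) y j)); last by ring.
by apply: idealD => //; [exact: idealMr|exact: idealMl].
Qed.

Lemma sum_option (A : nmodType) (T : finType) (f : option T -> A) :
  \sum_j f j = f None + \sum_t f (Some t).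
Proof.
rewrite (bigD1 None) //=; congr (_ + _).
by rewrite (reindex_omap Some id) => [|[]//]; apply: eq_bigl => t; rewrite eqxx.
Qed.

Section SingularPoints.
Variables (kappa : fieldType) (m : nat) (l : 'I_m -> nat).
Variables (lam : 'I_m -> kappa) (mu : kappa).
Hypothesis lam_neq0 : forall a, lam a != 0.
Notation R := (coord_ring kappa l).
Notation cont a n := (continuant (zseq kappa l a) n).
Notation var := (@Defs.var kappa m l).
Notation uvar := (Defs.uvar kappa l).
Notation wvar := (Defs.wvar kappa l).
Notation F := (Defs.F l lam).
Notation G := (Defs.G l mu).
Notation d t := (mderiv (enum_rank t)).
Implicit Types (P Q : spec R) (a b c : 'I_m) (i j n : nat) (t : Defs.coord l) (f g : R).

Lemma mpolyC_sign n : ((-1) ^+ n)%:MP = (-1) ^+ n :> R.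
Proof. by elim: n => [|n IHn]; rewrite ?expr0 ?mpolyC1 // !exprS mpolyCM IHn mpolyCN mpolyC1. Qed.

Lemma prime_mpolyC P x : P x%:MP -> x = 0.
Proof.
move=> Px; apply/eqP; apply: contrapT => /negP x0.
by apply: (@prime_unit _ P x%:MP x^-1%:MP) => //; rewrite -mpolyCM divff.
Qed.

Lemma deriv_var t t' : d t (var t') = (t == t')%:R.
Proof.
rewrite mderivX mnm1E (inj_eq enum_rank_inj) eq_sym; case: eqP => [->|_].
  by rewrite -{1}[U_(_)%MM]add0m addmK mpolyX0 scale1r.
by rewrite scale0r.
Qed.

Lemma deriv1 t : d t (1 : R) = 0. Proof. by rewrite -[1]mpolyC1 mderivC. Qed.

Lemma deriv_continuant0 t a n : (forall i, (0 < i <= n)%N -> zcoord l a i != t) ->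
  d t (cont a n) = 0.
Proof.
elim/nat_ind2: n => [_|h|n IHn IHn1 h]; first exact: deriv1.
  by change (d t (zseq kappa l a 1) = 0); rewrite zseqE deriv_var eq_sym (negbTE (h _ _)).
rewrite continuantSS mderivB mderivM IHn1 ?IHn => [|i /andP[i0 le]|i /andP[i0 le]].
- by rewrite zseqE deriv_var eq_sym (negbTE (h _ _)) ?ltnSn // mul0r mulr0 addr0 subr0.
- by apply: h; rewrite i0 (leq_trans le) // -addn2 leq_addr.
- by apply: h; rewrite i0 leqW.
Qed.

Lemma deriv_continuant_other a b i n : b != a -> d (zcoord l a i) (cont b n) = 0.
Proof. by move=> ba; apply: deriv_continuant0 => j _; rewrite zcoord_neq. Qed.

Lemma deriv_prod0 t (p : pred 'I_m) (f : 'I_m -> R) :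
  (forall b, p b -> d t (f b) = 0) -> d t (\prod_(b | p b) f b) = 0.
Proof.
move=> f0; elim/big_ind: _ => //; first exact: deriv1.
by move=> x y dx dy; rewrite mderivM dx dy mul0r mulr0 addr0.
Qed.

Lemma deriv_zseq a i j : (0 < i <= (l a).+1)%N -> (0 < j <= (l a).+1)%N ->
  d (zcoord l a i) (zseq kappa l a j) = (i == j)%:R.
Proof. by move=> hi hj; rewrite zseqE deriv_var zcoord_eq. Qed.

Lemma deriv_F_w a : d (inr true) (F a) = 0.
Proof.
by rewrite mderivB mderiv_mulC deriv_continuant0 // deriv_var mulr0 subrr.
Qed.

Lemma deriv_F_u a : d (inr false) (F a) = - (lam a)%:MP.
Proof.
by rewrite mderivB mderiv_mulC deriv_continuant0 // deriv_var eqxx mulr1 sub0r.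
Qed.

Lemma deriv_F_z a b i : d (zcoord l a i) (F b) =
  if b == a then d (zcoord l a i) (cont a (l a).+1) else 0.
Proof.
rewrite mderivB mderiv_mulC deriv_var mulr0 subr0.
by case: eqVneq => [->//|ba]; rewrite deriv_continuant_other.
Qed.

Lemma deriv_G_w : d (inr true) G = uvar.
Proof.
rewrite !mderivB mderivC mderivM !deriv_var deriv_prod0 => [|b _].
  by rewrite eqxx mul0r mulr1 add0r !subr0.
exact: deriv_continuant0.
Qed.

Lemma deriv_G_u : d (inr false) G = wvar.
Proof.
rewrite !mderivB mderivC mderivM !deriv_var deriv_prod0 => [|b _].
  by rewrite eqxx mul1r mulr0 addr0 !subr0.
exact: deriv_continuant0.
Qed.

Lemma deriv_G_z a i : d (zcoord l a i) G =
  - (d (zcoord l a i) (cont a (l a)) * \prod_(b | b != a) cont b (l b)).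
Proof.
rewrite !mderivB mderivC mderivM !deriv_var mul0r mulr0 addr0 sub0r subr0.
rewrite (bigD1 a) //= mderivM deriv_prod0 ?mulr0 ?addr0 // => b ba.
exact: deriv_continuant_other.
Qed.

Lemma critical_block P a n : (n <= (l a).+1)%N ->
  (forall i, (0 < i <= n)%N -> P (d (zcoord l a i) (cont a n))) ->
  ~~ odd n /\ forall i, (0 < i <= n)%N -> P (zseq kappa l a i).
Proof.
apply: (@critical_continuant _ _ (l a).+1 (fun i => d (zcoord l a i))).
- by move=> i x y; rewrite mderivB.
- by move=> i x y; rewrite mderivM.
- exact: deriv_zseq.
Qed.

Lemma deriv_continuant_top a : d (zcoord l a (l a).+1) (cont a (l a).+1) = cont a (l a).
Proof.
apply: (@derivation_continuant_last _ _ (l a).+1 (fun i => d (zcoord l a i))) => //.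
- by move=> i x y; rewrite mderivB.
- by move=> i x y; rewrite mderivM.
- exact: deriv_zseq.
Qed.

Definition sgn a : kappa := (-1) ^+ odd_half (l a).
Lemma sgnK a : sgn a * sgn a = 1. Proof. by rewrite /sgn -expr2 sqrr_sign. Qed.
Lemma sgn_neq0 a : sgn a != 0. Proof. by rewrite /sgn signr_eq0. Qed.

Lemma block_zeros P a :
  (forall i, (0 < i <= (l a).+1)%N -> P (zseq kappa l a i)) <->
  range (@zvar kappa m l a) `<=` P.
Proof.
split=> [Pz _ [i _ <-]|h i /andP[i0 le]]; last by apply: h; exists (inord i.-1).
have := Pz i.+1; rewrite /zseq inord_val; apply.
by rewrite ltnS ltn_ord.
Qed.

Section Singular.
Variables (P : spec R) (XP : X lam mu `<=` P).
Let iP := primeI P.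

Let PF a : P (F a). Proof. by apply: XP; left; exists a. Qed.
Let PG : P G. Proof. by apply: XP; right. Qed.

Lemma odd_block_u a : odd (l a) -> (forall i, (0 < i <= (l a).+1)%N -> P (zseq kappa l a i)) ->
  P (uvar - (sgn a * (lam a)^-1)%:MP).
Proof.
move=> oa Pz; have := @continuant_even _ P (zseq kappa l a) (l a).+1.
rewrite /= oa => /(_ isT Pz) /(ideal_gen_min iP (@square_sub _ P)) Pc.
have -> : uvar - (sgn a * (lam a)^-1)%:MP = (lam a)^-1%:MP *
    ((cont a (l a).+1 - (-1) ^+ (l a).+1./2) - F a).
  have h : (lam a)^-1%:MP * (lam a)%:MP = 1 :> R by rewrite -mpolyCM mulVf // mpolyC1.
  have es : (-1) ^+ (l a).+1./2 = (sgn a)%:MP :> R.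
    by rewrite /sgn mpolyC_sign.
  by rewrite /Defs.F es mpolyCM -{1}[uvar]mul1r -h; ring.
by apply: idealMl => //; exact: idealB.
Qed.

Lemma odd_pair_zeros a b : a != b -> odd (l a) -> odd (l b) ->
  (forall i, (0 < i <= (l a).+1)%N -> P (zseq kappa l a i)) ->
  (forall i, (0 < i <= (l b).+1)%N -> P (zseq kappa l b i)) ->
  compatible l lam a b /\ C_pair lam mu a b P.
Proof.
move=> ab oa ob Pa Pb; have [ua ub] := (odd_block_u oa Pa, odd_block_u ob Pb).
have e : sgn a * (lam a)^-1 = sgn b * (lam b)^-1.
  apply/eqP; rewrite -subr_eq0; apply/eqP; apply: (@prime_mpolyC P).
  rewrite mpolyCB.
  rewrite [X in P X](_ : _ = (uvar - (sgn b * (lam b)^-1)%:MP) - (uvar - (sgn a * (lam a)^-1)%:MP));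
    last by ring.
  exact: idealB.
split.
  rewrite /compatible (negbTE ab) oa ob /= /sgn_lambda -/(sgn a) -/(sgn b).
  apply/eqP; apply: invr_inj; rewrite !invfM.
  have sV c : (sgn c)^-1 = sgn c by apply: (mulfI (sgn_neq0 c)); rewrite divff ?sgn_neq0 ?sgnK.
  by rewrite !sV mulrC e mulrC.
(* The odd continuant P_(l_a) puts the product in G into [P], so that u w is congruent to [mu]; the
   factor [sgn a * lam a] is the inverse of the value of u. *)
have Pw : P (wvar - (sgn a * lam a * mu)%:MP).
  have Pprod : P (\prod_(c < m) cont c (l c)).
    rewrite (bigD1 a) //=; apply: idealMr => //; apply: continuant_odd => // i /andP[i0 le].
    by apply: Pa; rewrite i0 leqW.
  have -> : wvar - (sgn a * lam a * mu)%:MP = (sgn a * lam a)%:MP *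
      (G + \prod_(c < m) cont c (l c) - wvar * (uvar - (sgn a * (lam a)^-1)%:MP)).
    rewrite /Defs.G !mpolyCM.
    have h : (sgn a)%:MP * (lam a)%:MP * ((sgn a)%:MP * (lam a)^-1%:MP) = 1 :> R.
      rewrite -!mpolyCM -[1]mpolyC1; congr (_%:MP).
      by rewrite mulrACA sgnK mul1r divff.
    rewrite -{1}[wvar]mul1r -h; ring.
  by apply: idealMl => //; apply: idealB => //; [exact: idealD|exact: idealMl].
split=> [f [[fa|fb]|[->|->]]|c _ f ->] //=.
- by move: f fa; apply/block_zeros.
- by move: f fb; apply/block_zeros.
rewrite -/(sgn a) [X in P X](_ : _ = F c + (lam c)%:MP * (uvar - (sgn a * (lam a)^-1)%:MP)).
  by apply: idealD => //; exact: idealMl.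
rewrite /Defs.F mulrBr addrA subrK -mpolyCM; congr (_ - _%:MP).
by rewrite mulrA [lam c * _]mulrC.
Qed.

Lemma singular_cases (rF : 'I_m -> R) (rG : R) :
  (forall t, P (rG * d t G + \sum_a rF a * d t (F a))) ->
  (~ P rG \/ exists a, ~ P (rF a)) ->
  (exists a b, [/\ a != b, compatible l lam a b & C_pair lam mu a b P]) \/
  (all_even_case l mu /\ origin P).
Proof.
move=> H nz.
have Hw : P (rG * uvar).
  have := H (inr true); rewrite deriv_G_w big1 ?addr0 // => a _.
  by rewrite deriv_F_w mulr0.
have Hu : P (rG * wvar - \sum_a rF a * (lam a)%:MP).
  have := H (inr false); rewrite deriv_G_u -sumrN; congr (P (_ + _)).
  by apply: eq_bigr => a _; rewrite deriv_F_u mulrN.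
have Hz a i : P (rF a * d (zcoord l a i) (cont a (l a).+1) -
    rG * (d (zcoord l a i) (cont a (l a)) * \prod_(b | b != a) cont b (l b))).
  have e : \sum_b rF b * d (zcoord l a i) (F b) = rF a * d (zcoord l a i) (cont a (l a).+1).
    rewrite (bigD1 a) // big1 => [|b ba]; first by rewrite deriv_F_z eqxx; exact: addr0.
    by rewrite deriv_F_z (negbTE ba) mulr0.
  by have := H (zcoord l a i); rewrite deriv_G_z e mulrN addrC.
case: (pselect (P rG)) => [PrG|nrG].
  left; have blk a : ~ P (rF a) -> odd (l a) /\
      forall i, (0 < i <= (l a).+1)%N -> P (zseq kappa l a i).
    move=> na; have [|i _|oa Pz] := @critical_block P a (l a).+1 => //.
      have := Hz a i; rewrite idealDl //; last by apply: idealN => //; exact: idealMr.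
      by move=> /primeM[].
    by split=> //; move: oa; rewrite /= negbK.
  case: nz => // -[a na].
  (* The derivative by u puts the sum of the [rF c * lam c] into [P], and the [lam c] are units, so
     a single coefficient outside [P] is impossible. *)
  have [b ba nb] : exists2 b, a != b & ~ P (rF b).
    apply: contrapT => nex; have Pb b : b != a -> P (rF b).
      by move=> ba; apply: contrapT => nb; apply: nex; exists b => //; rewrite eq_sym.
    have : P (\sum_c rF c * (lam c)%:MP).
      rewrite -(subKr (rG * wvar) (\sum_c _)); apply: idealB => //; exact: idealMr.
    rewrite (bigD1 a) //= idealDl //; last first.
      by apply: ideal_sum => // c ca; apply: idealMr => //; exact: Pb.
    by move=> /primeM[//|/prime_mpolyC/eqP]; rewrite (negbTE (lam_neq0 a)).
  have [oa Pa] := blk a na; have [ob Pb] := blk b nb.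
  by have [cab Cab] := odd_pair_zeros ba oa ob Pa Pb; exists a, b.
(* With u in [P], each F_a puts P_(l_a + 1) into [P] and hence P_(l_a) outside. The last variable of
   block [a] does not occur in G, so its derivative forces [rF a] into [P]. *)
right; have Pu : P uvar by case: (primeM Hw).
have Pc1 a : P (cont a (l a).+1).
  have := PF a; rewrite /Defs.F idealDl //; apply: idealN => //; exact: idealMl.
have nPc a : ~ P (cont a (l a)) by move=> h; exact: (continuant_comaximal h (Pc1 a)).
have PrF a : P (rF a).
  have := Hz a (l a).+1; rewrite deriv_continuant_top deriv_continuant0.
    by rewrite mul0r mulr0 subr0 => /primeM[//|/nPc].
  by move=> i /andP[i0 le]; rewrite zcoord_eq ?i0 ?(leqW le) ?leqnn // neq_ltn ltnS le.
have Pw : P wvar.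
  have : P (rG * wvar).
    by move: Hu; rewrite idealDl //; apply: idealN => //; apply: ideal_sum => // a _; exact: idealMr.
  by move=> /primeM[].
(* Only the contribution of G is left, and its cofactor is a product of continuants outside [P]; so
   P_(l_a), one variable shorter than in F_a, is critical. *)
have blk a : ~~ odd (l a) /\ forall i, (0 < i <= l a)%N -> P (zseq kappa l a i).
  apply: critical_block => // i hi.
  have := Hz a i; rewrite addrC idealDl //; last exact: idealMr.
  rewrite -mulrN => /primeM[//|]; rewrite -mulNr => /primeM[|h].
    by move=> /(idealN iP); rewrite opprK.
  by exfalso; move: h; apply: prime_prod => b _; exact: nPc.
have Pz a i : (0 < i <= (l a).+1)%N -> P (zseq kappa l a i).
  have [ea Pz] := blk a; case/andP => i0; rewrite leq_eqVlt => /predU1P[->|lt]; last first.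
    by apply: Pz; rewrite i0.
  have : P (zseq kappa l a (l a).+1 * cont a (l a)).
    have := Pc1 a; rewrite continuantS; case E: (l a) ea Pz => [|n] ea Pz.
      by rewrite subr0.
    rewrite idealDl //; apply: idealN => //; apply: continuant_odd.
      by move: ea; rewrite /= negbK.
    by move=> j /andP[j0 le]; apply: Pz; rewrite j0 leqW.
  by move=> /primeM[//|/nPc].
split; last first.
  move=> _ [[[a i]|[]] _ <-] //.
  by have /block_zeros h := @Pz a; apply: h; exists i.
exists (fun a => (l a)./2).
  by move=> a; rewrite mul2n even_halfK //; case: (blk a).
apply: (@prime_mpolyC P); rewrite mpolyCD.
(* Modulo [P], G is now the negative of a constant, which must vanish in [kappa]. *)
have Pprod : P (\prod_(a < m) cont a (l a) - \prod_(a < m) (-1) ^+ (l a)./2).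
  apply: ideal_prod_congr => // a; apply: (ideal_gen_min iP (@square_sub _ P)).
  by have [ea Pza] := blk a; exact: continuant_even.
rewrite mpolyC_sign -prodrXr.
rewrite [X in P X](_ : _ = uvar * wvar - (\prod_(a < m) cont a (l a) - \prod_(a < m) (-1) ^+ (l a)./2) - G).
  by apply: idealB => //; apply: idealB => //; exact: idealMr.
rewrite /Defs.G; ring.
Qed.

End Singular.
End SingularPoints.

(** * The singular locus as a set of primes *)

Section SingularLocus.
Variables (kappa : fieldType) (m : nat) (l : 'I_m -> nat).
Variables (lam : 'I_m -> kappa) (mu : kappa).
Hypothesis lam_neq0 : forall a, lam a != 0.
Notation R := (coord_ring kappa l).
Notation cont a n := (continuant (zseq kappa l a) n).
Notation uvar := (Defs.uvar kappa l).
Notation wvar := (Defs.wvar kappa l).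
Notation F := (Defs.F l lam).
Notation G := (Defs.G l mu).
Implicit Types (P Q : spec R) (a b c : 'I_m).

Lemma coord_ring_noetherian : noetherian R.
Proof. by have [] := mpoly_regular_ring kappa #|{: Defs.coord l}|. Qed.

Definition equation (o : option 'I_m) : R := if o is Some a then F a else G.

Lemma X_equations : X lam mu = [set` map equation (enum {: option 'I_m})].
Proof.
apply/seteqP; split=> f.
  by case=> [[a _ <-]|->]; apply/mapP; [exists (Some a)|exists None]; rewrite ?mem_enum.
by move=> /= /mapP[[a|] _ ->]; [left; exists a|right].
Qed.

Lemma regular_or_singular P (XP : zeros (X lam mu) P) : regular_at XP \/
  (exists a b, [/\ a != b, compatible l lam a b & C_pair lam mu a b P]) \/
  (all_even_case l mu /\ origin P).
Proof.
case: (pselect (forall r : option 'I_m -> R,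
    (forall i, P (\sum_o r o * mderiv i (equation o))) -> forall o, P (r o))) => [jac|njac].
  left; have eqP o : P (equation o) by case: o => [a|]; apply: XP; [left; exists a|right].
  have [_ /(_ P)[g [gP Pg ch]]] := mpoly_regular_ring kappa #|{: Defs.coord l}|.
  have ind := jacobian_independent (enum_uniq {: option 'I_m}) eqP jac.
  move: XP; rewrite X_equations => XP.
  exact: (@regular_at_of_independent _ coord_ring_noetherian _ P XP g gP Pg ch ind).
right; have [r [rP [o nro]]] : exists r : option 'I_m -> R,
    (forall i, P (\sum_o r o * mderiv i (equation o))) /\ exists o, ~ P (r o).
  apply: contrapT => nex; apply: njac => r rP o; apply: contrapT => nr.
  by apply: nex; exists r; split=> //; exists o.
apply: (@singular_cases _ _ _ lam mu lam_neq0 P XP (fun a => r (Some a)) (r None)).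
  by move=> t; have := rP (enum_rank t); rewrite sum_option.
by case: o nro => [a|] nr; [right; exists a|left].
Qed.

Lemma not_regular_at_X P (XP : zeros (X lam mu) P) (f : R) (fs : seq R) :
  X lam mu = [set` fs] `|` [set f] -> size fs = m -> saturation P ([set` fs] `|` square P) f ->
  (forall Q : spec R, X lam mu `<=` Q -> Q `<=` P -> chain_below set0 Q m.+1) ->
  ~ regular_at XP.
Proof.
move=> XE sfs dep ch; apply: (not_regular_at_of_dependent coord_ring_noetherian XE dep).
by move=> e che; rewrite sfs; apply: chain_below_add che ch.
Qed.

(** Here G itself lies in P^2: u w does, and the product of continuants is congruent to a sign that
    equals [- mu]. *)
Lemma origin_singular P : all_even_case l mu -> origin P -> Sing (X lam mu) P.
Proof.
move=> [k lk kmu] Po; have iP := primeI P; have i2 := ideal_gen_ideal (square P).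
have Pu : P uvar by apply: Po; exists (inr false).
have Pw : P wvar by apply: Po; exists (inr true).
have Pz a i : P (zseq kappa l a i) by apply: Po; exists (zcoord l a i).
have ev a : ~~ odd (l a) by rewrite lk mul2n odd_double.
have Pc1 a : P (cont a (l a).+1) by apply: continuant_odd => //=; exact: ev.
have nPc a : ~ P (cont a (l a)) by move=> h; exact: (continuant_comaximal h (Pc1 a)).
have G2 : ideal_gen (square P) G.
  have e : \prod_(a < m) (-1) ^+ (l a)./2 = - mu%:MP :> R.
    under eq_bigr do rewrite lk mul2n doubleK.
    by rewrite prodrXr -mpolyC_sign -mpolyCN; congr _%:MP; apply/eqP; rewrite -addr_eq0 kmu.
  rewrite [X in ideal_gen _ X](_ : _ = uvar * wvar -
    (\prod_(a < m) cont a (l a) - \prod_(a < m) (-1) ^+ (l a)./2)); last first.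
    by rewrite e opprK opprD addrA.
  apply: (idealB i2); first by apply: ideal_gen_sub; exists uvar, wvar.
  by apply: (ideal_prod_congr _ i2) => a; apply: continuant_even.
have XP : zeros (X lam mu) P.
  move=> f [[a _ <-]|->]; last exact: (ideal_gen_min iP (@square_sub _ P)).
  by apply: idealB => //; exact: idealMl.
exists XP; apply: (@not_regular_at_X P XP G (map F (enum 'I_m))).
- congr (_ `|` _); apply/seteqP; split=> [_ [a _ <-]|f /= /mapP[a _ ->]].
    by apply/mapP; exists a; rewrite ?mem_enum.
  by exists a.
- by rewrite size_map -cardE card_ord.
- apply: sub_saturation; move: G2; apply: ideal_genS => f; by right.
- by move=> Q XQ QP; apply: chain_below_X_continuant XQ _ => a Qc; apply: (nPc a); exact: QP.
Qed.

(** Modulo P^2, F_a and F_b are both affine in u alone, and compatibility makes them proportional;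
    F_a is the equation that depends on the others. *)
Lemma C_pair_singular a b P : a != b -> compatible l lam a b -> C_pair lam mu a b P ->
  Sing (X lam mu) P.
Proof.
move=> ab; rewrite /compatible (negbTE ab) /= => /and3P[oa ob /eqP eab] [h1 h2].
have iP := primeI P; have i2 := ideal_gen_ideal (square P).
have Pza : forall i, (0 < i <= (l a).+1)%N -> P (zseq kappa l a i).
  by apply/block_zeros => f fa; apply: h1; left; left.
have Pzb : forall i, (0 < i <= (l b).+1)%N -> P (zseq kappa l b i).
  by apply/block_zeros => f fb; apply: h1; left; right.
set xu := sgn kappa l a * (lam a)^-1; set xw := sgn kappa l a * lam a * mu.
have Pu : P (uvar - xu%:MP) by apply: h1; right; left.
have Pw : P (wvar - xw%:MP) by apply: h1; right; right.
have xu0 : xu != 0 by rewrite mulf_neq0 ?sgn_neq0 ?invr_eq0.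
have nPu : ~ P uvar.
  move=> hu; have /prime_mpolyC/eqP : P xu%:MP; last exact/negP.
  by rewrite -(subKr uvar xu%:MP); exact: idealB.
have top2 c : odd (l c) -> (forall i, (0 < i <= (l c).+1)%N -> P (zseq kappa l c i)) ->
    ideal_gen (square P) (cont c (l c).+1 - (sgn kappa l c)%:MP).
  by move=> oc Pzc; rewrite mpolyC_sign; apply: continuant_even => //=; rewrite oc.
have [ta tb] := (top2 a oa Pza, top2 b ob Pzb).
have sV c : (sgn kappa l c)^-1 = sgn kappa l c :> kappa.
  by apply: (mulfI (sgn_neq0 _ l c)); rewrite divff ?sgn_neq0 ?sgnK.
have exu : sgn kappa l b * (lam b)^-1 = xu :> kappa.
  rewrite /xu -[sgn kappa l a]sV -[sgn kappa l b]sV -!invfM; congr (_^-1).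
  by rewrite mulrC [RHS]mulrC; exact/esym.
have PF c : P (F c).
  have hc : P (cont c (l c).+1 - (lam c * xu)%:MP).
    case: (eqVneq c a) => [->|ca].
      have := ideal_gen_min iP (@square_sub _ P) ta.
      by rewrite /xu mulrCA divff // mulr1.
    case: (eqVneq c b) => [->|cb].
      have := ideal_gen_min iP (@square_sub _ P) tb.
      by rewrite -exu mulrCA divff // mulr1.
    have := h2 c (conj ca cb) _ erefl; congr (P (_ - _%:MP)).
    by rewrite /xu mulrA [lam c * _]mulrC.
  have -> : F c = (cont c (l c).+1 - (lam c * xu)%:MP) - (lam c)%:MP * (uvar - xu%:MP).
    by rewrite /Defs.F mpolyCM; ring.
  by apply: idealB => //; exact: idealMl.
have PG : P G.
  have Pprod : P (\prod_(c < m) cont c (l c)).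
    rewrite (bigD1 a) //; apply: idealMr => //; apply: continuant_odd => // i /andP[i0 le].
    by apply: Pza; rewrite i0 leqW.
  have -> : G = uvar * (wvar - xw%:MP) + xw%:MP * (uvar - xu%:MP) - \prod_(c < m) cont c (l c).
    have emu : mu = xw * xu.
      by rewrite /xw /xu mulrC mulrA [_ * _ * (sgn kappa l a * _)]mulrACA sgnK mul1r mulVf // mul1r.
    by rewrite /Defs.G {1}emu mpolyCM; ring.
  by apply: idealB => //; apply: idealD => //; exact: idealMl.
have XP : zeros (X lam mu) P by move=> f [[c _ <-]|->].
exists XP; apply: (@not_regular_at_X P XP (F a) (G :: map F (rem a (enum 'I_m)))).
- rewrite set_cons; apply/seteqP; split=> f.
    case=> [[c _ <-]|->]; last by left; right.
    case: (eqVneq c a) => [->|ca]; first by right.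
    by left; left; apply: map_f; rewrite mem_rem_uniq ?enum_uniq // !inE ca mem_enum.
  by case=> [[/= /mapP[c _ ->]|->]|->]; [left|right|left].
- rewrite /= size_map size_rem ?mem_enum // -cardE card_ord prednK //.
  (* The predecessor of [m] is harmless: [a] shows that [m] is positive. *)
  by case: (m) a {ab oa eab h1 h2 Pza xu xw Pu Pw xu0 nPu ta exu PF PG XP} => // -[].
- apply: sub_saturation; set J := ideal_gen _.
  have iJ : is_ideal J by exact: ideal_gen_ideal.
  have J2 : ideal_gen (square P) `<=` J by apply: ideal_genS => f; right.
  have JFb : J (F b).
    apply: ideal_gen_sub; left; rewrite set_cons; left; apply: map_f.
    by rewrite mem_rem_uniq ?enum_uniq // !inE eq_sym ab mem_enum.
  (* The factor matches the terms in u, and by compatibility also the signs; what remains are the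
     deviations of the two continuants from their signs, which lie in P^2. *)
  have -> : F a = (lam a * (lam b)^-1)%:MP * F b + (cont a (l a).+1 - (sgn kappa l a)%:MP) -
      (lam a * (lam b)^-1)%:MP * (cont b (l b).+1 - (sgn kappa l b)%:MP).
    have e1 : (sgn kappa l a)%:MP = (lam a * (lam b)^-1)%:MP * (sgn kappa l b)%:MP :> R.
      rewrite -mpolyCM; congr (_%:MP).
      by rewrite -mulrA [_^-1 * _]mulrC exu /xu mulrCA divff // mulr1.
    have e2 : (lam a)%:MP = (lam a * (lam b)^-1)%:MP * (lam b)%:MP :> R.
      by rewrite -mpolyCM mulfVK.
    by rewrite /Defs.F e1 e2; ring.
  apply: (idealB iJ); last by apply: (idealMl _ iJ); exact: J2.
  by apply: (idealD iJ); [exact: (idealMl _ iJ)|exact: J2].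
- by move=> Q XQ QP; apply: chain_below_X_u XQ _ => Qu; apply: nPu; exact: QP.
Qed.

Lemma singular_locus P : Sing (X lam mu) P <->
  (exists a b, [/\ a != b, compatible l lam a b & C_pair lam mu a b P]) \/
  (all_even_case l mu /\ origin P).
Proof.
split=> [[XP nreg]|[[a [b [ab cab Cab]]]|[ae Po]]].
- by case: (regular_or_singular XP).
- exact: C_pair_singular Cab.
- exact: origin_singular.
Qed.

Lemma compatible_odd a b : a != b -> compatible l lam a b -> odd (l a).
Proof. by rewrite /compatible => /negbTE -> /and3P[]. Qed.

Lemma all_even_not_compatible a b : all_even_case l mu -> a != b -> ~ compatible l lam a b.
Proof. by move=> [k lk _] ab /(compatible_odd ab); rewrite lk mul2n odd_double. Qed.

Lemma compatible_refl a : compatible l lam a a. Proof. by rewrite /compatible eqxx. Qed.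
Lemma compatible_sym a b : compatible l lam a b = compatible l lam b a.
Proof. by rewrite /compatible eq_sym andbCA [sgn_lambda _ _ _ == _]eq_sym. Qed.
Lemma compatible_trans : transitive (compatible l lam).
Proof.
move=> b a c; rewrite /compatible; case: eqVneq => [->//|_] /=.
move=> /and3P[oa ob /eqP e]; case: eqVneq => [<- _|_ /= /and3P[_ oc /eqP e']].
  by rewrite oa ob e eqxx orbT.
by rewrite oa oc e e' eqxx orbT.
Qed.

Lemma compatible_sigma a : compatible l lam a (sigma l lam a).
Proof.
rewrite /sigma; case: arg_minnP => [|b]; first by rewrite inE compatible_refl.
by rewrite inE.
Qed.

Lemma compatible_pair_class a b : a != b -> compatible l lam a b ->
  [/\ sigma l lam a \in class_reps l lam, a \in compat_class l lam (sigma l lam a) &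
    b \in compat_class l lam (sigma l lam a)].
Proof.
move=> ab cab; have sa := compatible_sigma a; split.
- apply/imsetP; exists a => //; rewrite inE.
  have <- : #|[set a; b]%SET| = 2%N by rewrite cards2 ab.
  apply: subset_leq_card; apply/fintype.subsetP => c; rewrite !inE.
  by case/orP => /eqP ->; rewrite ?compatible_refl.
- by rewrite inE compatible_sym.
- by rewrite inE; apply: compatible_trans cab; rewrite compatible_sym.
Qed.

(** Compatibility is an equivalence relation, so every compatible pair of distinct indices lies in
    the class of its representative. *)
Lemma C_class_pairs P : (\bigcup_(r in [set` class_reps l lam]) C_class lam mu r) P <->
  exists a b, [/\ a != b, compatible l lam a b & C_pair lam mu a b P].
Proof.
split=> [[r _ [[a b] /= [ra rb ab] Cab]]|[a [b [ab cab Cab]]]].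
  exists a, b; split=> //; move: ra rb; rewrite !inE => ra rb.
  by apply: compatible_trans rb; rewrite compatible_sym.
have [sr sa sb] := compatible_pair_class ab cab.
by exists (sigma l lam a) => //; exists (a, b).
Qed.

Lemma compatible_caseP : compatible_case l lam <-> exists a b, a != b /\ compatible l lam a b.
Proof.
split=> [/card_gt0P[r /imsetP[a]]|[a [b [ab cab]]]]; last first.
  by have [sr _ _] := compatible_pair_class ab cab; apply/card_gt0P; exists (sigma l lam a).
rewrite inE => c2 _; have [b] : exists b, b \in compat_class l lam a :\ a.
  apply/card_gt0P; move: c2; rewrite (cardsD1 a) inE compatible_refl //.
by rewrite !inE => /andP[ba cab]; exists a, b; rewrite eq_sym.
Qed.

End SingularLocus.

(** * The constants lambda are nonzero *)

Section Coefficients.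
Variables (K : fieldType) (m : nat) (l : 'I_m -> nat) (eta : spec (laurent_ring K l)).
Variables (kappa : fieldType) (res : {rmorphism local_ring (zeros0 eta) -> kappa}).

(** The variables c are monomials, hence units of the Laurent ring, and ring morphisms preserve
    units. *)
Lemma c_image_neq0 j : c_image res j != 0.
Proof.
have [b cb] : exists b, cvar K j * b = 1 by apply: of_num_unit; exists U_(enum_rank j)%MM.
pose t := to_local_ring (zeros0 eta).
have tcb : t (cvar K j) * t b = 1.
  by apply: etrans (esym (to_local_ringM _ _ _)) _; rewrite cb; exact: to_local_ring1.
have : res (t (cvar K j)) * res (t b) = 1.
  apply: etrans (esym (rmorphM res _ _)) _; rewrite tcb; exact: rmorph1.
rewrite -/(c_image res j) => e; apply/eqP => c0.
by move: e; rewrite c0 mul0r => /esym/eqP; rewrite oner_eq0.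
Qed.

Lemma rho_neq0 (s : seq kappa) : (forall x, x \in s -> x != 0) -> rho s != 0.
Proof.
(* Induction on a bound for the size, since [rho] consumes two entries at a time. *)
have [n] := ubnP (size s); elim: n s => // n IHn [|x [|y s]] lt h /=.
- exact: oner_neq0.
- by apply: h; rewrite mem_head.
- apply: mulf_neq0; first by apply: h; rewrite mem_head.
  apply: IHn => [|z zs]; first by move: lt => /= /ltnW.
  by apply: h; rewrite !inE zs !orbT.
Qed.

Lemma c_seq_neq0 a x : x \in c_seq res a -> x != 0.
Proof. by move=> /mapP[i _ ->]; exact: c_image_neq0. Qed.

Lemma lambda_neq0 a : lambda res a != 0.
Proof. by rewrite invr_eq0; apply: rho_neq0 => x; exact: c_seq_neq0. Qed.

End Coefficients.

Theorem theorem3p3 (K : fieldType) (m : nat) (l : 'I_m -> nat)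
    (m_ge1 : (1 <= m)%N) (l_gt0 : forall a : 'I_m, (0 < l a)%N)
    (eta : spec (laurent_ring K l)) (eta_closed : closed_point eta)
    (kappa : fieldType) (res : {rmorphism local_ring (zeros0 eta) -> kappa})
    (res_surj : forall a : kappa, exists r, res r = a) :
  let lam := lambda res in
  let mu := mu res in
  let X := X lam mu in
  [/\ all_even_case l mu -> Sing X = origin (kappa := kappa) (l := l),
      compatible_case l lam ->
        Sing X = \bigcup_(r in [set` class_reps l lam]) C_class lam mu r &
      ~ all_even_case l mu -> ~ compatible_case l lam ->
        Sing X = set0 /\ regular_scheme X].
Proof.
move=> lam mu0 X0; have lam0 : forall a, lam a != 0 := lambda_neq0 res.
have SX := singular_locus mu0 lam0.
split=> [ae|cc|nae ncc].
- apply/seteqP; split=> P; last by move=> Po; apply/SX; right.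
  (* The first two cases exclude each other: distinct compatible indices have odd lengths. *)
  by move=> /SX[[a [b [ab cab _]]]|[]//]; case: (all_even_not_compatible ae ab cab).
- apply/seteqP; split=> P; last by move=> /C_class_pairs h; apply/SX; left.
  move=> /SX[h|[ae _]]; first exact/C_class_pairs.
  have [a [b [ab cab]]] := (compatible_caseP l lam).1 cc.
  by case: (all_even_not_compatible ae ab cab).
- have S0 : Sing X0 = set0.
    apply/seteqP; split=> P // /SX[[a [b [ab cab _]]]|[]//].
    by case: ncc; apply/compatible_caseP; exists a, b.
  split=> // P XP; apply: contrapT => nreg.
  by have : Sing X0 P by [exists XP]; rewrite S0.
Qed.
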